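(* Let $A$ be a finite left-symmetric conformal algebra which is free as a $\mathbb{C}[\partial]$-module. Let $\{e_i\}_{i=1}^n$ be a $\mathbb{C}[\partial]$-basis of $A$ and $\{e_i^*\}_{i=1}^n$ its dual basis in $A^{*c}$. Then $$r=\sum_{i=1}^n(e_i\otimes e_i^*+e_i^*\otimes e_i)$$ is a non-degenerate symmetric solution of the conformal $S$-equation in $A\ltimes_{L_A^*,0}A^{*c}$.
   Context: A left-symmetric conformal algebra is a $\mathbb{C}[\partial]$-module $A$ with a $\mathbb{C}$-bilinear map $A\times A\to A[\lambda]$, $(a,b)\mapsto a_\lambda b$, such that $(\partial a)_\lambda b=-\lambda a_\lambda b$, $a_\lambda(\partial b)=(\partial+\lambda)a_\lambda b$ and $(a_\lambda b)_{\lambda+\mu}c-a_\lambda(b_\mu c)=(b_\mu a)_{\lambda+\mu}c-b_\mu(a_\lambda c)$; put $[a_\lambda b]=a_\lambda b-b_{-\lambda-\partial}a$, where substituting $-\lambda-\partial$ for $\lambda$ in $\sum_n\lambda^nc_n$ means $\sum_n(-\lambda-\partial)^nc_n$. It is finite if finitely generated over $\mathbb{C}[\partial]$. Tensor products are over $\mathbb{C}$. The conformal dual $U^{*c}$ of a $\mathbb{C}[\partial]$-module $U$ is the set of $\mathbb{C}$-linear maps $f_\lambda:U\to\mathbb{C}[\lambda]$ with $f_\lambda(\partial u)=\lambda f_\lambda(u)$, with $(\partial f)_\lambda=-\lambda f_\lambda$; the dual basis satisfies $(e_i^* )_\lambda(e_k)=\delta_{ik}$. Define $L_A^*$ by $(L_A^*(a)_\lambda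 f)_\mu b=-f_{\mu-\lambda}(a_\lambda b)$ for $a,b\in A$, $f\in A^{*c}$. $A\ltimes_{L_A^*,0}A^{*c}$ is the left-symmetric conformal algebra on the $\mathbb{C}[\partial]$-module $A\oplus A^{*c}$ with product $(a+f)_\lambda(b+g)=a_\lambda b+L_A^*(a)_\lambda g$. For a left-symmetric conformal algebra $B$, free of finite rank over $\mathbb{C}[\partial]$, and $r=\sum_ir_i\otimes l_i\in B\otimes B$: $r$ is symmetric if $\sum_ir_i\otimes l_i=\sum_il_i\otimes r_i$. The conformal linear map corresponding to $r$ is $T^r_\lambda:B^{*c}\to B[\lambda]$, $T^r_\lambda(f)=\sum_if_{-\lambda-\partial}(r_i)\,l_i$ (with $\partial$ acting on $l_i$), and $T_0^r=T^r_\lambda|_{\lambda=0}$. The element $r$ is non-degenerate if $T_0^r:B^{*c}\to B$ is a $\mathbb{C}[\partial]$-module isomorphism. The conformal $S$-equation for $r=\sum_ir_i\otimes l_i$ in $B$ is $$\sum_{i,j}({l_j}_\mu r_i\otimes r_j\otimes l_i)|_{\mu=1\otimes\partial\otimes1}-\sum_{i,j}(r_j\otimes{l_j}_\mu r_i\otimes l_i)|_{\mu=\partial\otimes1\otimes1}-\sum_{i,j}(r_i\otimes r_j\otimes[{l_i}_\mu l_j])|_{\mu=\partial\otimes1\otimes1}=0\mod(\partial^{\otimes^3})$$ in $B\otimes B\otimes B$, where $\partial^{\otimes^3}=\partial\otimes1\otimes1+1\otimes\partial\otimes1+1\otimes1\otimes\partial$, ''mod $(\partial^{\otimes^3})$''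 means modulo $\partial^{\otimes^3}(B\otimes B\otimes B)$, and the subscript means each power $\mu^n$ is replaced by the $n$-th power of the indicated operator. *)

(* Defs.v *)
From HB Require Import structures.
From mathcomp Require Import all_boot all_order all_algebra.
From mathcomp Require Import generic_quotient complex.
From mathcomp Require Import boolp functions reals.

Set Implicit Arguments.
Unset Strict Implicit.
Unset Printing Implicit Defensive.

Import Order.TTheory GRing.Theory Num.Theory.
Local Open Scope ring_scope.
Local Open Scope quotient_scope.

(* V[x] for an R-module V: finitely supported sequences of coefficients.      *)
Section ModulePolynomials.
Variables (R : nzRingType) (V : lmodType R).

Definition lpoly_pred : {pred nat -> V} :=
  fun c => `[< exists N, forall n, (N <= n)%N -> c n = 0 >].

Fact lpoly_submod_closed : submod_closed lpoly_pred.
Proof.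
split; first by apply/asboolP; exists 0%N.
move=> k p q /asboolP[M hM] /asboolP[N hN]; apply/asboolP.
exists (maxn M N) => n; rewrite geq_max => /andP[hm hn].
by rewrite /GRing.add /= /GRing.scale /= hM// hN// scaler0 addr0.
Qed.

HB.instance Definition _ :=
  GRing.isSubmodClosed.Build R (nat -> V) lpoly_pred lpoly_submod_closed.

Record lpoly := LPoly {lcoef :> nat -> V; _ : lcoef \in lpoly_pred}.

HB.instance Definition _ := [isSub for lcoef].
HB.instance Definition _ := [Choice of lpoly by <:].
HB.instance Definition _ := [SubChoice_isSubLmodule of lpoly by <:].

Lemma lpolyP (p q : lpoly) : (forall n, p n = q n) -> p = q.
Proof. by move=> h; apply: val_inj; apply/funext => n; exact: h. Qed.

Lemma lcoefD (p q : lpoly) n : (p + q) n = p n + q n. Proof. by []. Qed.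
Lemma lcoefN (p : lpoly) n : (- p) n = - p n. Proof. by []. Qed.
Lemma lcoef0 n : (0 : lpoly) n = 0. Proof. by []. Qed.
Lemma lcoefZ k (p : lpoly) n : (k *: p) n = k *: p n. Proof. by []. Qed.

Fact lpoly_bound (p : lpoly) :
  exists N, `[< forall n, (N <= n)%N -> p n = 0 >].
Proof. by case: p => c /= /asboolP[N hN]; exists N; apply/asboolP. Qed.

Definition lsize (p : lpoly) : nat := ex_minn (lpoly_bound p).

Lemma lsizeP (p : lpoly) n : (lsize p <= n)%N -> p n = 0.
Proof. by rewrite /lsize; case: ex_minnP => m /asboolP h _; exact: h. Qed.

Lemma lsize_min (p : lpoly) N :
  (forall n, (N <= n)%N -> p n = 0) -> (lsize p <= N)%N.
Proof.
move=> h; rewrite /lsize; case: ex_minnP => m _; apply; exact/asboolP.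
Qed.

Fact lamC_subproof (v : V) : (fun n => if n is 0 then v else 0) \in lpoly_pred.
Proof. by apply/asboolP; exists 1%N => -[]. Qed.
Definition lamC (v : V) : lpoly := LPoly (lamC_subproof v).

Fact lamX_subproof (p : lpoly) :
  (fun n => if n is m.+1 then p m else 0) \in lpoly_pred.
Proof.
apply/asboolP; exists (lsize p).+1 => -[//|n]; rewrite ltnS; exact: lsizeP.
Qed.
Definition lamX (p : lpoly) : lpoly := LPoly (lamX_subproof p).

(* the substitution x := T in \sum_n x^n c_n: \sum_n T^n (f c_n)              *)
Definition psub (W : zmodType) (f : V -> W) (T : W -> W) (p : lpoly) : W :=
  \sum_(n < lsize p) iter n T (f (p n)).

End ModulePolynomials.

(* In V[lambda][mu], coefficients of mu are in V[lambda].                     *)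
Section TwoVariables.
Variables (R : nzRingType) (V : lmodType R).

Definition cst2 (v : V) : lpoly (lpoly V) := lamC (lamC v).
Definition mulmu : lpoly (lpoly V) -> lpoly (lpoly V) := @lamX R (lpoly V).
Definition mullam : lpoly (lpoly V) -> lpoly (lpoly V) :=
  psub (fun p : lpoly V => lamC (lamX p)) mulmu.

End TwoVariables.

Section LeftSymmetricConformalAlgebras.
Variable K : fieldType.

Section Product.
Variables (A : lmodType {poly K}) (m : A -> A -> lpoly A).

(* (a_S b)_T c and a_S (b_T c) in A[lambda, mu], for S, T linear polynomials  *)
(* in lambda and mu acting by multiplication                                  *)
Definition nestl (S T : lpoly (lpoly A) -> lpoly (lpoly A)) (a b c : A) :=
  psub (fun d => psub (@cst2 _ A) T (m d c)) S (m a b).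
Definition nestr (S T : lpoly (lpoly A) -> lpoly (lpoly A)) (a b c : A) :=
  psub (fun d => psub (@cst2 _ A) S (m a d)) T (m b c).

Definition mullammu (p : lpoly (lpoly A)) := mullam p + mulmu p.

Definition is_lsca : Prop :=
  [/\ (forall (k : K) (a a' b : A),
         m (k%:P *: a + a') b = k%:P *: m a b + m a' b),
      (forall (k : K) (a b b' : A),
         m a (k%:P *: b + b') = k%:P *: m a b + m a b'),
      (forall a b : A, m ('X *: a) b = - lamX (m a b)),
      (forall a b : A, m a ('X *: b) = 'X *: m a b + lamX (m a b)) &
      (forall a b c : A,
         nestl (@mullam _ A) mullammu a b c
           - nestr (@mullam _ A) (@mulmu _ A) a b c
         = nestl (@mulmu _ A) mullammu b a c
           - nestr (@mulmu _ A) (@mullam _ A) b a c)].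

End Product.

(* A C[d]-module is an lmodType {poly K}, with d acting as 'X.                *)
Record lsca := LSCA {
  lsca_mod :> lmodType {poly K};
  lprod : lsca_mod -> lsca_mod -> lpoly lsca_mod;
  lscaP : is_lsca lprod }.

(* multiplication by -lambda-d on U[lambda]                                   *)
Definition neglamdel (U : lmodType {poly K}) (p : lpoly U) : lpoly U :=
  - lamX p - 'X *: p.

Definition lbracket (A : lsca) (a b : A) : lpoly A :=
  lprod a b - psub (@lamC _ A) (@neglamdel A) (lprod b a).

Definition cfinite (U : lmodType {poly K}) : Prop :=
  exists (n : nat) (e : 'I_n -> U),
    forall u, exists c : 'I_n -> {poly K}, u = \sum_(i < n) c i *: e i.

Definition cbasis (U : lmodType {poly K}) (n : nat) (e : 'I_n -> U) : Prop :=
  (forall u, exists c : 'I_n -> {poly K}, u = \sum_(i < n) c i *: e i) /\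
  (forall c : 'I_n -> {poly K},
     \sum_(i < n) c i *: e i = 0 -> forall i, c i = 0).

End LeftSymmetricConformalAlgebras.

Arguments lprod {K l}.

Section ConformalDual.
Variables (K : fieldType) (U : lmodType {poly K}).

Definition cdual_pred : {pred U -> {poly K}} :=
  fun f => `[< (forall (k : K) (u v : U), f (k%:P *: u + v) = k *: f u + f v)
            /\ (forall u, f ('X *: u) = 'X * f u) >].

Fact cdual_zmod_closed : zmod_closed cdual_pred.
Proof.
split.
  have E u : (0 : U -> {poly K}) u = 0 by [].
  by apply/asboolP; split=> *; rewrite !E ?scaler0 ?addr0 ?mulr0.
move=> f g /asboolP[fL fX] /asboolP[gL gX].
have E u : (f - g) u = f u - g u by [].
apply/asboolP; split=> [k u v|u]; rewrite !E.
  by rewrite fL gL scalerBr opprD addrACA.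
by rewrite fX gX mulrBr.
Qed.

HB.instance Definition _ :=
  GRing.isZmodClosed.Build (U -> {poly K}) cdual_pred cdual_zmod_closed.

(* f u is f_lambda(u), the variable of {poly K} being lambda.                 *)
Record cdual := CDual {cdual_fun :> U -> {poly K}; _ : cdual_fun \in cdual_pred}.

HB.instance Definition _ := [isSub for cdual_fun].
HB.instance Definition _ := [Choice of cdual by <:].
HB.instance Definition _ := [SubChoice_isSubZmodule of cdual by <:].

Lemma cdualP (f g : cdual) : (forall u, f u = g u) -> f = g.
Proof. by move=> h; apply: val_inj; apply/funext => u; exact: h. Qed.

Lemma cdual_lin (f : cdual) (k : K) u v : f (k%:P *: u + v) = k *: f u + f v.
Proof. by case: f => f /= /asboolP[]. Qed.
Lemma cdualX (f : cdual) u : f ('X *: u) = 'X * f u.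
Proof. by case: f => f /= /asboolP[]. Qed.
Lemma cdualDE (f g : cdual) u : (f + g) u = f u + g u. Proof. by []. Qed.
Lemma cdualNE (f : cdual) u : (- f) u = - f u. Proof. by []. Qed.

Fact cdual_scale_subproof (p : {poly K}) (f : cdual) :
  (fun u => (p \Po (- 'X)) * f u) \in cdual_pred.
Proof.
apply/asboolP; split=> [k u v|u]; first by rewrite cdual_lin mulrDr scalerAr.
by rewrite cdualX mulrCA.
Qed.

(* (d f)_lambda = - lambda f_lambda, i.e. (p(d) f)_lambda = p(-lambda) f_lambda *)
Definition cdual_scale (p : {poly K}) (f : cdual) : cdual :=
  CDual (cdual_scale_subproof p f).

Fact cdual_scaleA p q f : cdual_scale p (cdual_scale q f) = cdual_scale (p * q) f.
Proof. by apply: cdualP => u /=; rewrite mulrA comp_polyM. Qed.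
Fact cdual_scale1 : left_id 1 cdual_scale.
Proof. by move=> f; apply: cdualP => u /=; rewrite comp_polyC mul1r. Qed.
Fact cdual_scaleDr : right_distributive cdual_scale +%R.
Proof. by move=> p f g; apply: cdualP => u /=; rewrite mulrDr. Qed.
Fact cdual_scaleDl f : {morph cdual_scale^~ f : p q / p + q}.
Proof. by move=> p q; apply: cdualP => u /=; rewrite comp_polyD mulrDl. Qed.

HB.instance Definition _ := GRing.Zmodule_isLmodule.Build {poly K} cdual
  cdual_scaleA cdual_scale1 cdual_scaleDr cdual_scaleDl.

Lemma cdualZE (p : {poly K}) (f : cdual) u : (p *: f) u = (p \Po (- 'X)) * f u.
Proof. by []. Qed.

End ConformalDual.
Section PsubTheory.
Variables (R : nzRingType) (V : lmodType R) (W : zmodType).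

Lemma iter_morphD (T : W -> W) : {morph T : x y / x + y} ->
  forall n, {morph iter n T : x y / x + y}.
Proof. by move=> TD; elim=> [//|n IH] x y; rewrite !iterS IH TD. Qed.

Lemma morphD0 (V1 V2 : zmodType) (T : V1 -> V2) :
  {morph T : x y / x + y} -> T 0 = 0.
Proof. by move=> TD; apply: (addrI (T 0)); rewrite -TD !addr0. Qed.

Lemma morphDN (V1 V2 : zmodType) (T : V1 -> V2) :
  {morph T : x y / x + y} -> {morph T : x / - x}.
Proof.
by move=> TD x; apply: (addrI (T x)); rewrite -TD !subrr morphD0.
Qed.

Lemma morphDsum (V1 V2 : zmodType) (T : V1 -> V2) (I : Type) (r : seq I) F :
  {morph T : x y / x + y} -> T (\sum_(i <- r) F i) = \sum_(i <- r) T (F i).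
Proof. by move=> TD; apply: big_morph => //; exact: morphD0. Qed.

Variables (f : V -> W) (T : W -> W).
Hypothesis fD : {morph f : x y / x + y}.
Hypothesis TD : {morph T : x y / x + y}.

Lemma psubE N (p : lpoly V) : (forall n, (N <= n)%N -> p n = 0) ->
  psub f T p = \sum_(n < N) iter n T (f (p n)).
Proof.
move=> hN; have le := lsize_min hN; rewrite /psub.
rewrite -(big_mkord xpredT (fun n => iter n T (f (p n)))).
rewrite -(big_mkord xpredT (fun n => iter n T (f (p n)))).
rewrite (@big_cat_nat _ _ _ (lsize p) 0 N)//= [X in _ + X]big1_seq ?addr0// => n /=.
rewrite mem_index_iota => /andP[/lsizeP -> _].
by rewrite (morphD0 fD) (morphD0 (iter_morphD TD n)).
Qed.

Lemma psubD (p q : lpoly V) : psub f T (p + q) = psub f T p + psub f T q.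
Proof.
set N := maxn (lsize p) (lsize q).
have hp n : (N <= n)%N -> p n = 0 by rewrite geq_max => /andP[/lsizeP].
have hq n : (N <= n)%N -> q n = 0 by rewrite geq_max => /andP[_ /lsizeP].
rewrite (psubE hp) (psubE hq) (@psubE N) => [|n hn]; last first.
  by rewrite lcoefD hp ?hq ?addr0.
by rewrite -big_split; apply: eq_bigr => n _; rewrite /= fD iter_morphD.
Qed.

Lemma psub_lamC v : psub f T (lamC v) = f v.
Proof. by rewrite (@psubE 1) ?big_ord1// => -[]. Qed.

Lemma psub_lamX p : psub f T (lamX p) = T (psub f T p).
Proof.
rewrite (@psubE (lsize p).+1) => [|[//|n]]; last by rewrite ltnS => /lsizeP.
rewrite big_ord_recl /= (morphD0 fD) add0r /psub (morphDsum _ _ TD).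
by apply: eq_bigr.
Qed.

End PsubTheory.

Section PsubComp.
Variables (R : nzRingType) (V : lmodType R) (W W' : zmodType).

Lemma psub_comp (g : W -> W') (f : V -> W) T T' (p : lpoly V) :
  {morph g : x y / x + y} -> (forall w, g (T w) = T' (g w)) ->
  g (psub f T p) = psub (g \o f) T' p.
Proof.
move=> gD gT; rewrite /psub (morphDsum _ _ gD); apply: eq_bigr => n _ /=.
by move: (f _) => w; elim: (nat_of_ord n) => //= m <-; exact: gT.
Qed.

Lemma eq_psub (f f' : V -> W) T T' (p : lpoly V) :
  f =1 f' -> T =1 T' -> psub f T p = psub f' T' p.
Proof.
move=> ff TT; apply: eq_bigr => n _ /=; rewrite ff.
by move: (f' _) => w; elim: (nat_of_ord n) => //= m ->; exact: TT.
Qed.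

End PsubComp.

Section Evaluation.
Variable K : numFieldType.

Definition leval (V : lmodType {poly K}) (x : K) (p : lpoly V) : V :=
  psub id (fun v => x%:P *: v) p.

Section One.
Variable V : lmodType {poly K}.
Implicit Types (p q : lpoly V) (x : K).

Lemma scaleD (P : {poly K}) : {morph (fun v : V => P *: v) : u v / u + v}.
Proof. by move=> u v; rewrite scalerDr. Qed.

Lemma levalE N x p : (forall n, (N <= n)%N -> p n = 0) ->
  leval x p = \sum_(n < N) (x ^+ n)%:P *: p n.
Proof.
move=> hN; rewrite /leval (psubE _ _ hN)//; last exact: scaleD.
apply: eq_bigr => n _; elim: (nat_of_ord n) (p n) => [|m IH] v /=.
  by rewrite expr0 scale1r.
by rewrite IH scalerA -polyCM -exprS.
Qed.

Lemma levalD x : {morph @leval V x : p q / p + q}.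
Proof. by move=> p q; apply: psubD => //; exact: scaleD. Qed.

Lemma levalZ x (P : {poly K}) p : leval x (P *: p) = P *: leval x p.
Proof.
rewrite (@levalE (lsize p)) => [|n /lsizeP h]; last by rewrite lcoefZ h scaler0.
rewrite (@levalE (lsize p)) => [|n /lsizeP //].
by rewrite scaler_sumr; apply: eq_bigr => n _; rewrite lcoefZ !scalerA mulrC.
Qed.

Lemma levalN x p : leval x (- p) = - leval x p.
Proof. exact: (morphDN (@levalD x)). Qed.

Lemma leval_lamC x (v : V) : leval x (lamC v) = v.
Proof. by rewrite /leval psub_lamC//; exact: scaleD. Qed.

Lemma leval_lamX x p : leval x (lamX p) = x%:P *: leval x p.
Proof. by rewrite /leval psub_lamX//; exact: scaleD. Qed.

Lemma leval_psub (W : zmodType) (f : V -> W) T x p :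
  {morph f : u v / u + v} -> (forall v, f (x%:P *: v) = T (f v)) ->
  psub f T p = f (leval x p).
Proof. by move=> fD fT; rewrite (psub_comp _ _ fD fT). Qed.

Lemma levalP p q : (forall x, leval x p = leval x q) -> p = q.
Proof.
move=> h; apply/eqP; rewrite -subr_eq0; apply/eqP.
have {h} : forall x, leval x (p - q) = 0.
  by move=> x; rewrite levalD levalN h subrr.
move: (p - q) => {p q} p; have [N] := ubnP (lsize p).
elim: N p => // N IH p; rewrite ltnS => hN h0.
have hp n : (N <= n)%N -> p n = 0 by move=> hn; exact/lsizeP/(leq_trans hN).
case: N => [|N] in IH hN hp *.
  by apply: lpolyP => n; rewrite hp.
have pz (n : nat) : (n < N)%N -> p n = 0.
  move=> nN; pose c n : {poly K} := ((2%:R : K) ^+ n - 2%:R ^+ N)%:P.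
  have hcp : (fun n => c n *: p n) \in @lpoly_pred _ V.
    by apply/asboolP; exists N.+1 => m /hp ->; rewrite scaler0.
  pose q : lpoly V := LPoly hcp.
  have q0 : q = 0.
    apply: IH.
      rewrite ltnS; apply: lsize_min => m /=; rewrite leq_eqVlt.
      by move=> /predU1P[<-|/hp ->]; rewrite ?scaler0// /c subrr scale0r.
    move=> x; rewrite (@levalE N.+1) => [|m hm]; last by rewrite /= hp ?scaler0.
    transitivity (leval (2%:R * x) p - (2%:R ^+ N)%:P *: leval x p); last first.
      by rewrite !h0 scaler0 subrr.
    rewrite !(levalE _ hp) scaler_sumr -sumrB; apply: eq_bigr => m _ /=.
    rewrite !scalerA -scalerBl -!polyCM -polyCB; congr (_%:P *: _).
    by rewrite exprMn mulrBr mulrC [in RHS](mulrC (_ ^+ N)).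
  have := congr1 (fun r : lpoly V => r n) q0 => /= e.
  have cn0 : (2%:R : K) ^+ n - 2%:R ^+ N != 0.
    rewrite subr_eq0 -!natrX eqr_nat; apply: contraTneq nN => /eqP.
    by rewrite eqn_exp2l// => /eqP ->; rewrite ltnn.
  move/(congr1 (fun v => (((2%:R : K) ^+ n - 2%:R ^+ N)^-1)%:P *: v)): e.
  by rewrite scaler0 scalerA -polyCM mulVf// scale1r.
apply: lpolyP => n; rewrite lcoef0.
case: (ltngtP n N) => [/pz//|/hp//|->].
have := h0 1; rewrite (levalE _ hp) big_ord_recr /= big1 ?add0r.
  by rewrite expr1n scale1r.
by move=> i _; rewrite pz ?scaler0.
Qed.

End One.

Section Two.
Variable V : lmodType {poly K}.
Implicit Types (p q : lpoly (lpoly V)) (x y : K).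

Definition leval2 x y p : V := leval x (leval y p).

Lemma leval2D x y : {morph leval2 x y : p q / p + q}.
Proof. by move=> p q; rewrite /leval2 !levalD. Qed.

Lemma leval2_cst x y (v : V) : leval2 x y (cst2 v) = v.
Proof. by rewrite /leval2 /cst2 !leval_lamC. Qed.

Lemma leval2_mu x y p : leval2 x y (mulmu p) = y%:P *: leval2 x y p.
Proof. by rewrite /leval2 /mulmu leval_lamX levalZ. Qed.

Lemma lamXD : {morph @lamX _ V : p q / p + q}.
Proof. by move=> p q; apply: lpolyP => -[|n]; rewrite lcoefD//= addr0. Qed.

Lemma lamXZ (P : {poly K}) (p : lpoly V) : lamX (P *: p) = P *: lamX p.
Proof. by apply: lpolyP => -[|n]; rewrite lcoefZ//= scaler0. Qed.

Lemma leval2_lam x y p : leval2 x y (mullam p) = x%:P *: leval2 x y p.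
Proof.
rewrite /leval2 /mullam (@psub_comp _ _ _ _ (leval y) _ _ (fun v => y%:P *: v));
  [|exact: levalD|by move=> w; rewrite /mulmu leval_lamX].
rewrite -leval_lamX; congr leval.
rewrite -(@leval_psub (lpoly V) (lpoly V) (@lamX _ V) (fun q : lpoly V => y%:P *: q)).
- by apply: eq_psub => // v /=; rewrite leval_lamC.
- exact: lamXD.
- by move=> v; rewrite lamXZ.
Qed.

Lemma leval2P p q : (forall x y, leval2 x y p = leval2 x y q) -> p = q.
Proof. by move=> h; apply: levalP => y; apply: levalP => x; exact: h. Qed.

Variable m : V -> V -> lpoly V.
Hypothesis mDl : forall (k : K) (a a' b : V),
         m (k%:P *: a + a') b = k%:P *: m a b + m a' b.
Hypothesis mDr : forall (k : K) (a b b' : V),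
         m a (k%:P *: b + b') = k%:P *: m a b + m a b'.

Lemma lprod_addl b : {morph m^~ b : u v / u + v}.
Proof. by move=> u v; have := mDl 1 u v b; rewrite !scale1r. Qed.
Lemma lprod_addr a : {morph m a : u v / u + v}.
Proof. by move=> u v; have := mDr 1 a u v; rewrite !scale1r. Qed.
Lemma lprod_scalel k a b : m (k%:P *: a) b = k%:P *: m a b.
Proof.
by have := mDl k a 0 b; rewrite (morphD0 (lprod_addl b)) !addr0.
Qed.
Lemma lprod_scaler k a b : m a (k%:P *: b) = k%:P *: m a b.
Proof.
by have := mDr k a b 0; rewrite (morphD0 (lprod_addr a)) !addr0.
Qed.

Variables (x y s t : K) (S T : lpoly (lpoly V) -> lpoly (lpoly V)).
Hypothesis hS : forall p, leval2 x y (S p) = s%:P *: leval2 x y p.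
Hypothesis hT : forall p, leval2 x y (T p) = t%:P *: leval2 x y p.

Lemma leval2_nestl a b c :
  leval2 x y (nestl m S T a b c) = leval t (m (leval s (m a b)) c).
Proof.
rewrite /nestl (psub_comp _ _ (@leval2D x y) hS).
rewrite -(@leval_psub _ _ (fun d => leval t (m d c)) (fun v : V => s%:P *: v)); last 2 first.
- by move=> u v; rewrite lprod_addl levalD.
- by move=> v; rewrite lprod_scalel levalZ.
apply: eq_psub => // d /=; rewrite (psub_comp _ _ (@leval2D x y) hT).
by apply: eq_psub => // v /=; rewrite leval2_cst.
Qed.

Lemma leval2_nestr a b c :
  leval2 x y (nestr m S T a b c) = leval s (m a (leval t (m b c))).
Proof.
rewrite /nestr (psub_comp _ _ (@leval2D x y) hT).
rewrite -(@leval_psub _ _ (fun d => leval s (m a d)) (fun v : V => t%:P *: v)); last 2 first.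
- by move=> u v; rewrite lprod_addr levalD.
- by move=> v; rewrite lprod_scaler levalZ.
apply: eq_psub => // d /=; rewrite (psub_comp _ _ (@leval2D x y) hS).
by apply: eq_psub => // v /=; rewrite leval2_cst.
Qed.

End Two.

(* Over an infinite field the last axiom may be checked at points.            *)
Lemma lsca_pointwiseP (V : lmodType {poly K}) (m : V -> V -> lpoly V) :
  (forall (k : K) (a a' b : V),
         m (k%:P *: a + a') b = k%:P *: m a b + m a' b) ->
  (forall (k : K) (a b b' : V),
         m a (k%:P *: b + b') = k%:P *: m a b + m a b') ->
  (forall a b c : V,
         nestl m (@mullam _ V) (@mullammu _ V) a b c
           - nestr m (@mullam _ V) (@mulmu _ V) a b c
         = nestl m (@mulmu _ V) (@mullammu _ V) b a c
           - nestr m (@mulmu _ V) (@mullam _ V) b a c) <->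
  (forall a b c (x y : K),
     leval (x + y) (m (leval x (m a b)) c) - leval x (m a (leval y (m b c)))
     = leval (x + y) (m (leval y (m b a)) c)
       - leval y (m b (leval x (m a c)))).
Proof.
move=> ml mr.
have hadd x y p : leval2 x y (@mullammu _ V p) = (x + y)%:P *: leval2 x y p.
  by rewrite /mullammu leval2D leval2_lam leval2_mu polyCD scalerDl.
have key a b c x y :
  (leval2 x y (nestl m (@mullam _ V) (@mullammu _ V) a b c
           - nestr m (@mullam _ V) (@mulmu _ V) a b c) =
   leval (x + y) (m (leval x (m a b)) c) - leval x (m a (leval y (m b c))))
 * (leval2 x y (nestl m (@mulmu _ V) (@mullammu _ V) a b c
           - nestr m (@mulmu _ V) (@mullam _ V) a b c) =
   leval (x + y) (m (leval y (m a b)) c) - leval y (m a (leval x (m b c)))).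
  have hl := @leval2_lam V x y; have hm := @leval2_mu V x y.
  rewrite !leval2D !(morphDN (@leval2D _ x y)).
  rewrite (leval2_nestl ml hl (hadd x y)) (leval2_nestr mr hl hm).
  by rewrite (leval2_nestl ml hm (hadd x y)) (leval2_nestr mr hm hl).
split=> h a b c => [x y|].
  by rewrite -(key a b c x y).1 h (key _ _ _ _ _).2.
apply: leval2P => x y.
by rewrite (key a b c x y).1 h (key _ _ _ _ _).2.
Qed.

End Evaluation.
Section PsubZ.
Variables (R : nzRingType) (V : lmodType R) (W : zmodType).

Lemma psubZ (f : V -> W) (T : W -> W) (g : W -> W) (k : R) (p : lpoly V) :
  {morph f : x y / x + y} -> {morph T : x y / x + y} ->
  {morph g : x y / x + y} -> (forall v, f (k *: v) = g (f v)) ->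
  (forall w, g (T w) = T (g w)) ->
  psub f T (k *: p) = g (psub f T p).
Proof.
move=> fD TD gD fk gT.
rewrite (@psubE _ _ _ _ _ fD TD (lsize p)) => [|n /lsizeP h]; last first.
  by rewrite lcoefZ h scaler0.
rewrite /psub (morphDsum _ _ gD); apply: eq_bigr => n _; rewrite lcoefZ fk.
by move: (f _) => w; elim: (nat_of_ord n) => //= m ->; rewrite gT.
Qed.

End PsubZ.

Section CDualTheory.
Variables (K : fieldType) (U : lmodType {poly K}).
Implicit Type f : cdual U.

Lemma cdualD f : {morph f : u v / u + v}.
Proof. by move=> u v; have := cdual_lin f 1 u v; rewrite !scale1r. Qed.

Lemma cdualC f (k : K) u : f (k%:P *: u) = k%:P * f u.
Proof.
by have := cdual_lin f k u 0; rewrite (morphD0 (cdualD f)) !addr0 mul_polyC.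
Qed.

Lemma cdual_poly f (p : {poly K}) u : f (p *: u) = p * f u.
Proof.
elim/poly_ind: p u => [|p k IH] u.
  by rewrite scale0r mul0r (morphD0 (cdualD f)).
by rewrite scalerDl cdualD cdualC -scalerA IH cdualX mulrDl mulrA.
Qed.

End CDualTheory.

Section DualAction.
Variables (K : numFieldType) (A : lsca K).

Lemma lscaDl (b : A) : {morph lprod^~ b : u v / u + v}.
Proof. by case: (lscaP A) => ml _ _ _ _; exact: lprod_addl. Qed.
Lemma lscaDr (a : A) : {morph lprod a : u v / u + v}.
Proof. by case: (lscaP A) => _ mr _ _ _; exact: lprod_addr. Qed.
Lemma lscaZl k (a b : A) : lprod (k%:P *: a) b = k%:P *: lprod a b.
Proof. by case: (lscaP A) => ml _ _ _ _; exact: lprod_scalel. Qed.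
Lemma lscaZr k (a b : A) : lprod a (k%:P *: b) = k%:P *: lprod a b.
Proof. by case: (lscaP A) => _ mr _ _ _; exact: lprod_scaler. Qed.
Lemma lscaXl (a b : A) : lprod ('X *: a) b = - lamX (lprod a b).
Proof. by case: (lscaP A) => _ _ + _ _; exact. Qed.
Lemma lscaXr (a b : A) : lprod a ('X *: b) = 'X *: lprod a b + lamX (lprod a b).
Proof. by case: (lscaP A) => _ _ _ + _; exact. Qed.
Lemma lsca_leval (a b c : A) x y :
  leval (x + y) (lprod (leval x (lprod a b)) c)
    - leval x (lprod a (leval y (lprod b c)))
  = leval (x + y) (lprod (leval y (lprod b a)) c)
    - leval y (lprod b (leval x (lprod a c))).
Proof.
case: (lscaP A) => ml mr _ _ ls; have [h _] := lsca_pointwiseP ml mr.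
exact: (h ls).
Qed.

Variable a : A.
Variable f : cdual A.

(* - f_{mu-lambda}(a_lambda b) in C[mu][lambda]: the outer variable 'X is     *)
(* lambda, the inner variable 'X%:P is mu.                                    *)
Definition Ldual_poly (b : A) : {poly {poly K}} :=
  - psub (fun c => (f c)^:P \Po ('X%:P - 'X)) (fun q => 'X * q) (lprod a b).

Let f0 (c : A) : {poly {poly K}} := (f c)^:P \Po ('X%:P - 'X).
Let f0D : {morph f0 : u v / u + v}.
Proof. by move=> u v; rewrite /f0 cdualD rmorphD comp_polyD. Qed.
Let mulD (p : {poly {poly K}}) : {morph (fun q => p * q) : u v / u + v}.
Proof. by move=> u v; rewrite mulrDr. Qed.

Lemma Ldual_polyD : {morph Ldual_poly : u v / u + v}.
Proof.
by move=> u v; rewrite /Ldual_poly lscaDr (psubD f0D (mulD 'X)) opprD.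
Qed.

Lemma Ldual_polyC (k : K) b : Ldual_poly (k%:P *: b) = k%:P%:P * Ldual_poly b.
Proof.
rewrite /Ldual_poly lscaZr mulrN; congr (- _).
apply: (psubZ (g := fun q => k%:P%:P * q) _ f0D) => [||v|w]; try exact: mulD.
- by rewrite /f0 cdualC rmorphM /= map_polyC /= comp_polyM comp_polyC.
- by rewrite mulrCA.
Qed.

Lemma Ldual_polyX b : Ldual_poly ('X *: b) = 'X%:P * Ldual_poly b.
Proof.
rewrite /Ldual_poly lscaXr (psubD f0D (mulD 'X)) (psub_lamX f0D (mulD 'X)).
rewrite (psubZ (g := fun q => ('X%:P - 'X) * q) _ f0D) => [||||w].
- by rewrite -mulrDl subrK mulrN.
- exact: mulD.
- exact: mulD.
- by move=> v; rewrite /f0 cdualX rmorphM /= map_polyX comp_polyM comp_polyX.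
- by rewrite mulrCA.
Qed.

Fact Ldual_coef_subproof n : (fun b => (Ldual_poly b)`_n) \in @cdual_pred K A.
Proof.
apply/asboolP; split=> [k u v|u].
  by rewrite Ldual_polyD Ldual_polyC coefD coefCM mul_polyC.
by rewrite Ldual_polyX coefCM.
Qed.

Definition Ldual_coef n : cdual A := CDual (Ldual_coef_subproof n).

Hypothesis Afin : cfinite A.

Fact Ldual_subproof : Ldual_coef \in @lpoly_pred _ (cdual A).
Proof.
apply/asboolP; have [m [e gen]] := Afin.
exists (\max_(i < m) size (Ldual_poly (e i))) => n hn.
apply: cdualP => b; have [c ->] := gen b.
rewrite (morphDsum _ _ (cdualD _)) big1// => i _.
rewrite cdual_poly [X in _ * X]nth_default ?mulr0//.
by apply: leq_trans hn; exact: (leq_bigmax i).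
Qed.

(* L_A^*(a)_lambda f, defined by (L_A^*(a)_lambda f)_mu b =                   *)
(* - f_{mu-lambda}(a_lambda b)                                                *)
Definition Ldual : lpoly (cdual A) := LPoly Ldual_subproof.

Lemma leval_Ldual x b :
  (leval x Ldual) b = - (f (leval x (lprod a b)) \Po ('X - x%:P)).
Proof.
set N := maxn (lsize Ldual) (size (Ldual_poly b)).
rewrite (@levalE _ _ N) => [|n]; last by rewrite geq_max => /andP[/lsizeP].
rewrite (@morphDsum _ _ (fun g : cdual A => g b))//.
transitivity ((Ldual_poly b).[x%:P]).
  rewrite (@horner_coef_wide _ N) ?leq_maxr//; apply: eq_bigr => n _.
  by rewrite cdualZE comp_polyC mulrC rmorphXn.
rewrite /Ldual_poly hornerN; congr (- _).
rewrite (@psub_comp _ _ _ _ (fun q => q.[x%:P]) _ _ (fun q => x%:P * q)).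
- rewrite -(@leval_psub _ _ _ (fun c => f c \Po ('X - x%:P)) (fun q => x%:P * q)).
  + by apply: eq_psub => // c /=; rewrite horner_comp !hornerE.
  + by move=> u v; rewrite cdualD comp_polyD.
  + by move=> v; rewrite cdualC comp_polyM comp_polyC.
- by move=> u v; rewrite hornerD.
- by move=> w; rewrite hornerM hornerX.
Qed.

End DualAction.

Section SemidirectProduct.
Variables (K : numFieldType).

Section Pair.
Variables (R : nzRingType) (V1 V2 : lmodType R) (p : lpoly V1) (q : lpoly V2).

Fact lpair_subproof : (fun n => (p n, q n)) \in @lpoly_pred _ (V1 * V2)%type.
Proof.
apply/asboolP; exists (maxn (lsize p) (lsize q)) => n.
by rewrite geq_max => /andP[/lsizeP -> /lsizeP ->].
Qed.
Definition lpair : lpoly (V1 * V2)%type := LPoly lpair_subproof.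

End Pair.

Lemma leval_lpair (V1 V2 : lmodType {poly K}) (p : lpoly V1) (q : lpoly V2) x :
  leval x (lpair p q) = (leval x p, leval x q).
Proof.
have hN n : (maxn (lsize p) (lsize q) <= n)%N -> p n = 0 /\ q n = 0.
  by rewrite geq_max => /andP[/lsizeP -> /lsizeP ->].
rewrite !(@levalE _ _ (maxn (lsize p) (lsize q))) => [|n /hN[]//|n /hN[]//|n].
  rewrite [LHS]surjective_pairing (@morphDsum _ _ fst)// (@morphDsum _ _ snd)//.
by move=> /hN /= [-> ->].
Qed.

Variables (A : lsca K) (Afin : cfinite A).
Let B := (A * cdual A)%type.

Definition sdprod (u v : B) : lpoly B :=
  lpair (lprod u.1 v.1) (Ldual u.1 v.2 Afin).

Let comp2D (q : {poly K}) : {morph (fun p => p \Po q) : u v / u + v}.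
Proof. by move=> u v; rewrite comp_polyD. Qed.

Fact sdprod_is_lsca : is_lsca sdprod.
Proof.
have levL x (p q : lpoly B) k : leval x (k *: p + q) = k *: leval x p + leval x q.
  by rewrite levalD levalZ.
have ml (k : K) (a a' b : B) :
    sdprod (k%:P *: a + a') b = k%:P *: sdprod a b + sdprod a' b.
  apply: levalP => x; rewrite levL !leval_lpair; congr pair.
    by rewrite /= lscaDl lscaZl levalD levalZ.
  apply: cdualP => c; rewrite cdualDE cdualZE !leval_Ldual comp_polyC.
  rewrite lscaDl lscaZl levalD levalZ cdualD cdualC comp_polyD comp_polyM.
  by rewrite comp_polyC mulrN opprD.
have mr (k : K) (a b b' : B) :
    sdprod a (k%:P *: b + b') = k%:P *: sdprod a b + sdprod a b'.
  apply: levalP => x; rewrite levL !leval_lpair; congr pair.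
    by rewrite /= lscaDr lscaZr levalD levalZ.
  apply: cdualP => c; rewrite cdualDE cdualZE !leval_Ldual comp_polyC.
  by rewrite cdualDE cdualZE comp_polyD comp_polyM !comp_polyC mulrN opprD.
split=> //.
- move=> a b; apply: levalP => x; rewrite levalN leval_lamX !leval_lpair.
  congr pair; first by rewrite /= lscaXl levalN leval_lamX.
  apply: cdualP => c; rewrite cdualNE cdualZE !leval_Ldual comp_polyC.
  rewrite lscaXl levalN leval_lamX (morphDN (cdualD _)) cdualC.
  by rewrite (morphDN (comp2D _)) comp_polyM comp_polyC mulrN.
- move=> a b; apply: levalP => x; rewrite levalD levalZ leval_lamX !leval_lpair.
  congr pair; first by rewrite /= lscaXr levalD levalZ leval_lamX.
  apply: cdualP => c; rewrite cdualDE !cdualZE !leval_Ldual comp_polyC.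
  rewrite cdualZE comp_polyX comp_polyM (morphDN (comp2D _)) comp_polyX.
  by rewrite !mulrN mulNr opprK mulNr opprK mulrBl.
- apply/(lsca_pointwiseP ml mr) => a b c x y; rewrite !leval_lpair /=.
  congr pair; first exact: lsca_leval.
  apply: cdualP => d; rewrite !cdualDE !cdualNE !leval_Ldual.
  rewrite !(morphDN (comp2D _)) -!comp_polyA !opprK.
  rewrite !(comp_polyD, comp_polyX, (morphDN (comp2D _)), comp_polyC).
  have -> : 'X - x%:P - y%:P = 'X - (x + y)%:P :> {poly K}.
    by rewrite polyCD opprD addrA.
  have -> : 'X - y%:P - x%:P = 'X - (x + y)%:P :> {poly K}.
    by rewrite polyCD opprD addrA addrAC.
  rewrite -!opprD -!comp_polyD -!cdualD; congr (- (c.2 _ \Po _)).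
  by apply/eqP; rewrite -subr_eq addrAC (lsca_leval a.1 b.1 d x y) subrK.
Qed.

Definition semidirect : lsca K := LSCA sdprod_is_lsca.

End SemidirectProduct.
(* U (x)_K V: finite formal sums of pairs, identified when every K-bilinear   *)
(* map takes the same value on them (the universal property).                 *)
Section TensorProduct.
Variables (K : comNzRingType) (U V : lmodType K).

Definition bilin (W : lmodType K) (phi : U -> V -> W) : Prop :=
  (forall v, linear (phi^~ v)) /\ (forall u, linear (phi u)).

Definition tensor_eqv (s t : seq (U * V)) : bool :=
  `[< forall (W : lmodType K) (phi : U -> V -> W), bilin phi ->
        \sum_(p <- s) phi p.1 p.2 = \sum_(p <- t) phi p.1 p.2 >].

Fact tensor_eqv_refl : reflexive tensor_eqv.
Proof. by move=> s; apply/asboolP. Qed.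
Fact tensor_eqv_sym : symmetric tensor_eqv.
Proof.
by move=> s t; apply/idP/idP => /asboolP h; apply/asboolP => W phi /h.
Qed.
Fact tensor_eqv_trans : transitive tensor_eqv.
Proof.
move=> t s u /asboolP h1 /asboolP h2; apply/asboolP => W phi b.
by rewrite h1// h2.
Qed.

Canonical tensor_equiv :=
  EquivRel tensor_eqv tensor_eqv_refl tensor_eqv_sym tensor_eqv_trans.

Definition tensor := {eq_quot tensor_equiv}.
HB.instance Definition _ := Choice.on tensor.
HB.instance Definition _ := EqQuotient.on tensor.

Definition tens (u : U) (v : V) : tensor := \pi_tensor [:: (u, v)].

(* tsum phi t is \sum_i phi u_i v_i for t = \sum_i u_i (x) v_i; it does not   *)
(* depend on the presentation of t when phi is bilinear, see tsum_sum.        *)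
Definition tsum (W : zmodType) (phi : U -> V -> W) (t : tensor) : W :=
  \sum_(p <- repr t) phi p.1 p.2.

Lemma tsum_pi (W : lmodType K) (phi : U -> V -> W) s : bilin phi ->
  tsum phi (\pi_tensor s) = \sum_(p <- s) phi p.1 p.2.
Proof.
move=> b; have /eqquotP/asboolP h : repr (\pi_tensor s) = s %[mod tensor].
  by rewrite reprK.
exact: h.
Qed.

Lemma tensorP (x y : tensor) :
  (forall (W : lmodType K) (phi : U -> V -> W), bilin phi ->
     tsum phi x = tsum phi y) -> x = y.
Proof.
by move=> h; rewrite -[x]reprK -[y]reprK; apply/eqquotP/asboolP.
Qed.

Definition tzero : tensor := \pi_tensor [::].
Definition topp (x : tensor) : tensor :=
  \pi_tensor [seq (- p.1, p.2) | p <- repr x].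
Definition tadd (x y : tensor) : tensor := \pi_tensor (repr x ++ repr y).
Definition tscale (k : K) (x : tensor) : tensor :=
  \pi_tensor [seq (k *: p.1, p.2) | p <- repr x].

Section Bilin.
Variables (W : lmodType K) (phi : U -> V -> W).
Hypothesis b : bilin phi.

Lemma bilinDl v : {morph phi^~ v : x y / x + y}.
Proof. by move=> x y; have := b.1 v 1 x y; rewrite !scale1r. Qed.
Lemma bilinDr u : {morph phi u : x y / x + y}.
Proof. by move=> x y; have := b.2 u 1 x y; rewrite !scale1r. Qed.
Lemma bilinZl k u v : phi (k *: u) v = k *: phi u v.
Proof. by have := b.1 v k u 0; rewrite (morphD0 (bilinDl v)) !addr0. Qed.
Lemma bilinZr k u v : phi u (k *: v) = k *: phi u v.
Proof. by have := b.2 u k v 0; rewrite (morphD0 (bilinDr u)) !addr0. Qed.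

Lemma tsum_zero : tsum phi tzero = 0.
Proof. by rewrite tsum_pi// big_nil. Qed.
Lemma tsum_opp x : tsum phi (topp x) = - tsum phi x.
Proof.
rewrite tsum_pi// big_map /tsum -sumrN; apply: eq_bigr => p _ /=.
exact: (morphDN (bilinDl _)).
Qed.
Lemma tsum_add x y : tsum phi (tadd x y) = tsum phi x + tsum phi y.
Proof. by rewrite tsum_pi// big_cat. Qed.
Lemma tsum_scale k x : tsum phi (tscale k x) = k *: tsum phi x.
Proof.
rewrite tsum_pi// big_map /tsum scaler_sumr; apply: eq_bigr => p _ /=.
exact: bilinZl.
Qed.
Lemma tsum_tens u v : tsum phi (tens u v) = phi u v.
Proof. by rewrite tsum_pi// big_seq1. Qed.

End Bilin.

Fact taddA : associative tadd.
Proof. by move=> x y z; apply: tensorP => W phi b; rewrite !tsum_add// addrA. Qed.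
Fact taddC : commutative tadd.
Proof. by move=> x y; apply: tensorP => W phi b; rewrite !tsum_add// addrC. Qed.
Fact tadd0 : left_id tzero tadd.
Proof.
by move=> x; apply: tensorP => W phi b; rewrite tsum_add// tsum_zero// add0r.
Qed.
Fact taddN : left_inverse tzero topp tadd.
Proof.
move=> x; apply: tensorP => W phi b.
by rewrite tsum_add// tsum_opp// tsum_zero// addNr.
Qed.

HB.instance Definition _ :=
  GRing.isZmodule.Build tensor taddA taddC tadd0 taddN.

Fact tscaleA j k x : tscale j (tscale k x) = tscale (j * k) x.
Proof. by apply: tensorP => W phi b; rewrite !tsum_scale// scalerA. Qed.
Fact tscale1 : left_id 1 tscale.
Proof. by move=> x; apply: tensorP => W phi b; rewrite tsum_scale// scale1r. Qed.
Fact tscaleDr : right_distributive tscale +%R.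
Proof.
move=> k x y; apply: tensorP => W phi b.
by rewrite !(tsum_scale, tsum_add)// scalerDr.
Qed.
Fact tscaleDl x : {morph tscale^~ x : j k / j + k}.
Proof.
move=> j k; apply: tensorP => W phi b.
by rewrite tsum_scale// tsum_add// !tsum_scale// scalerDl.
Qed.

HB.instance Definition _ :=
  GRing.Zmodule_isLmodule.Build K tensor tscaleA tscale1 tscaleDr tscaleDl.

Lemma tens_bilin : bilin tens.
Proof.
split=> [v k x y|u k x y]; apply: tensorP => W phi b;
  by rewrite tsum_add// tsum_scale// !tsum_tens// ?b.1 ?b.2.
Qed.

Lemma tsum_linear (W : lmodType K) (phi : U -> V -> W) :
  bilin phi -> linear (tsum phi).
Proof. by move=> b k x y; rewrite tsum_add// tsum_scale. Qed.

Lemma tsum_sum (W : lmodType K) (phi : U -> V -> W) (I : Type) (r : seq I)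
    (u : I -> U) (v : I -> V) : bilin phi ->
  tsum phi (\sum_(i <- r) tens (u i) (v i)) = \sum_(i <- r) phi (u i) (v i).
Proof.
move=> b; rewrite (@morphDsum _ _ (tsum phi)); last exact: tsum_add.
by apply: eq_bigr => i _; rewrite tsum_tens.
Qed.

Lemma tensorE (t : tensor) : t = \sum_(p <- repr t) tens p.1 p.2.
Proof.
apply: tensorP => W phi b; rewrite tsum_sum//.
Qed.

End TensorProduct.

(* the K-vector space underlying a K[d]-module                                *)
Definition kmod (K : fieldType) (U : lmodType {poly K}) : Type := U.

Section RestrictionOfScalars.
Variables (K : fieldType) (U : lmodType {poly K}).

HB.instance Definition _ := GRing.Zmodule.on (kmod U).

Definition kscale (k : K) (u : kmod U) : kmod U := k%:P *: (u : U).

Fact kscaleA j k u : kscale j (kscale k u) = kscale (j * k) u.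
Proof. by rewrite /kscale scalerA -polyCM. Qed.
Fact kscale1 : left_id 1 kscale.
Proof. by move=> u; rewrite /kscale scale1r. Qed.
Fact kscaleDr : right_distributive kscale +%R.
Proof. by move=> k u v; rewrite /kscale scalerDr. Qed.
Fact kscaleDl u : {morph kscale^~ u : j k / j + k}.
Proof. by move=> j k; rewrite /kscale polyCD scalerDl. Qed.

HB.instance Definition _ := GRing.Zmodule_isLmodule.Build K (kmod U)
  kscaleA kscale1 kscaleDr kscaleDl.

End RestrictionOfScalars.

Section ConformalSEquation.
Variables (K : fieldType).

Definition tensor2 (U : lmodType {poly K}) := tensor (kmod U) (kmod U).
Definition tensor3 (U : lmodType {poly K}) := tensor (tensor2 U) (kmod U).

Definition tens2 (U : lmodType {poly K}) (u v : U) : tensor2 U :=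
  @tens K (kmod U) (kmod U) u v.
Definition tens3 (U : lmodType {poly K}) (u v w : U) : tensor3 U :=
  @tens K (tensor2 U) (kmod U) (tens2 u v) w.

Definition tmap (U1 V1 U2 V2 : lmodType K) (f : U1 -> U2) (g : V1 -> V2) :
    tensor U1 V1 -> tensor U2 V2 :=
  tsum (fun u v => tens (f u) (g v)).

Section Module.
Variable U : lmodType {poly K}.

Definition del (u : kmod U) : kmod U := 'X *: (u : U).

Definition del1 : tensor3 U -> tensor3 U :=
  tmap (tmap del id : tensor2 U -> tensor2 U) id.
Definition del2 : tensor3 U -> tensor3 U :=
  tmap (tmap id del : tensor2 U -> tensor2 U) id.
Definition del3 : tensor3 U -> tensor3 U := tmap id del.

Definition tensor_symmetric (r : tensor2 U) : Prop :=
  r = tsum (fun u v => tens v u) r.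

(* f_{-lambda-d}(u) v in U[lambda], with d acting on v                        *)
Definition cdual_act (f : cdual U) (u v : U) : lpoly U :=
  \sum_(k < size (f u)) ((f u)`_k)%:P *: iter k (@neglamdel K U) (lamC v).

Definition Tlam (r : tensor2 U) (f : cdual U) : lpoly U :=
  tsum (fun u v : kmod U => cdual_act f u v) r.

Definition Tzero (r : tensor2 U) (f : cdual U) : U := Tlam r f 0%N.

Definition tensor_nondegenerate (r : tensor2 U) : Prop :=
  linear (Tzero r) /\ bijective (Tzero r).

End Module.

(* the summand of the conformal S-equation, with [l_i_mu l_j] in the last slot *)
Definition Sterm (B : lsca K) (ri li rj lj : B) : tensor3 B :=
    psub (fun c : B => tens3 c rj li) (@del2 B) (lprod lj ri)
  - psub (fun c : B => tens3 rj c li) (@del1 B) (lprod lj ri)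
  - psub (fun c : B => tens3 ri rj c) (@del1 B) (lbracket li lj).

Definition Sexpr (B : lsca K) (r : tensor2 B) : tensor3 B :=
  tsum (fun ri li : kmod B => tsum (fun rj lj : kmod B => Sterm ri li rj lj) r) r.

Definition conformal_S_equation (B : lsca K) (r : tensor2 B) : Prop :=
  exists t : tensor3 B, Sexpr r = del1 t + del2 t + del3 t.

End ConformalSEquation.
(* The definitions above do not depend on the presentation of r.              *)
Section Presentations.
Variable K : numFieldType.

Section Module.
Variable U : lmodType {poly K}.

Lemma tens2P : bilin (@tens2 K U : kmod U -> kmod U -> tensor2 U).
Proof. exact: tens_bilin. Qed.

Lemma tens3_lin1 (v w : U) : linear (fun u : kmod U => tens3 u v w).
Proof.
by move=> k x y; rewrite /tens3 tens2P.1 (tens_bilin (tensor2 U) (kmod U)).1.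
Qed.
Lemma tens3_lin2 (u w : U) : linear (fun v : kmod U => tens3 u v w).
Proof.
by move=> k x y; rewrite /tens3 tens2P.2 (tens_bilin (tensor2 U) (kmod U)).1.
Qed.
Lemma tens3_lin3 (u v : U) : linear (fun w : kmod U => tens3 u v w).
Proof. by move=> k x y; rewrite /tens3 (tens_bilin (tensor2 U) (kmod U)).2. Qed.

Lemma linD (V W : lmodType K) (f : V -> W) : linear f -> {morph f : x y / x + y}.
Proof. by move=> fl x y; have := fl 1 x y; rewrite !scale1r. Qed.
Lemma linZ (V W : lmodType K) (f : V -> W) : linear f ->
  forall k x, f (k *: x) = k *: f x.
Proof. by move=> fl k x; have := fl k x 0; rewrite (morphD0 (linD fl)) !addr0. Qed.

Lemma tmap_bilin (U1 V1 U2 V2 : lmodType K) (f : U1 -> U2) (g : V1 -> V2) :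
  linear f -> linear g -> bilin (fun u v => tens (f u) (g v)).
Proof.
move=> fl gl; split=> [v k x y|u k x y].
  by rewrite fl (tens_bilin _ _).1.
by rewrite gl (tens_bilin _ _).2.
Qed.

Lemma tmap_linear (U1 V1 U2 V2 : lmodType K) (f : U1 -> U2) (g : V1 -> V2) :
  linear f -> linear g -> linear (tmap f g).
Proof. by move=> fl gl; apply: tsum_linear; exact: tmap_bilin. Qed.

Lemma tmap_tens (U1 V1 U2 V2 : lmodType K) (f : U1 -> U2) (g : V1 -> V2) u v :
  linear f -> linear g -> tmap f g (tens u v) = tens (f u) (g v).
Proof. by move=> fl gl; rewrite /tmap tsum_tens//; exact: tmap_bilin. Qed.

Lemma del_linear : linear (@del K U).
Proof.
move=> k x y; rewrite /del scalerDr; congr (_ + _).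
by rewrite [LHS]scalerA mulrC -scalerA.
Qed.
Lemma id_linear (V : lmodType K) : linear (@id V). Proof. by []. Qed.

Lemma del1_linear : linear (@del1 K U).
Proof.
apply: tmap_linear; last exact: id_linear.
by apply: tmap_linear; [exact: del_linear|exact: id_linear].
Qed.
Lemma del2_linear : linear (@del2 K U).
Proof.
apply: tmap_linear; last exact: id_linear.
by apply: tmap_linear; [exact: id_linear|exact: del_linear].
Qed.
Lemma del3_linear : linear (@del3 K U).
Proof. by apply: tmap_linear; [exact: id_linear|exact: del_linear]. Qed.

Lemma del1_tens (u v w : U) : del1 (tens3 u v w) = tens3 ('X *: u) v w.
Proof.
rewrite /del1 /tens3 /tens2 !tmap_tens//; try exact: del_linear.
by apply: tmap_linear; [exact: del_linear|exact: id_linear].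
Qed.
Lemma del2_tens (u v w : U) : del2 (tens3 u v w) = tens3 u ('X *: v) w.
Proof.
rewrite /del2 /tens3 /tens2 !tmap_tens//; try exact: del_linear.
by apply: tmap_linear; [exact: id_linear|exact: del_linear].
Qed.
Lemma del3_tens (u v w : U) : del3 (tens3 u v w) = tens3 u v ('X *: w).
Proof. by rewrite /del3 /tens3 tmap_tens//; exact: del_linear. Qed.

(* linearity of the substitution x := T in p and in f                         *)
Lemma psub_lin (W : lmodType K) (f : U -> W) (T : W -> W) (k : K) (p q : lpoly U) :
  linear (f : kmod U -> W) -> linear T ->
  psub f T (k%:P *: p + q) = k *: psub f T p + psub f T q.
Proof.
move=> fl Tl; have fD : {morph f : x y / x + y} := linD fl.
rewrite (psubD fD (linD Tl)); congr (_ + _).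
apply: (psubZ (g := fun w => k *: w) _ fD (linD Tl)) => [x y|v|w].
- by rewrite scalerDr.
- exact: (linZ fl k v).
- by rewrite (linZ Tl).
Qed.

Lemma psub_linf (W : lmodType K) (f g h : U -> W) (T : W -> W) (k : K) (p : lpoly U) :
  linear T -> (forall u, h u = k *: f u + g u) ->
  psub h T p = k *: psub f T p + psub g T p.
Proof.
move=> Tl hE; rewrite /psub scaler_sumr -big_split; apply: eq_bigr => n _ /=.
rewrite hE; move: (f _) (g _) => x y.
by elim: (nat_of_ord n) => //= m ->; rewrite Tl.
Qed.

Lemma neglamdelD : {morph @neglamdel K U : p q / p + q}.
Proof.
by move=> p q; rewrite /neglamdel lamXD scalerDr !opprD addrACA.
Qed.
Lemma neglamdelZ P p : neglamdel (P *: p) = P *: @neglamdel K U p.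
Proof. by rewrite /neglamdel lamXZ scalerBr scalerN !scalerA mulrC. Qed.

Lemma cdual_act_bilin (f : cdual U) :
  bilin (fun u v : kmod U => cdual_act f u v : kmod (lpoly U)).
Proof.
pose act N u v : lpoly U :=
  \sum_(k < N) ((f u)`_k)%:P *: iter k (@neglamdel K U) (lamC v).
have actE N u v : (size (f u) <= N)%N -> cdual_act f u v = act N u v.
  move=> le; rewrite /act /cdual_act.
  rewrite -(big_mkord xpredT
    (fun k => ((f u)`_k)%:P *: iter k (@neglamdel K U) (lamC v))).
  rewrite -(big_mkord xpredT
    (fun k => ((f u)`_k)%:P *: iter k (@neglamdel K U) (lamC v))).
  rewrite [RHS](@big_cat_nat _ _ _ (size (f u)))//= [X in _ + X]big1_seq ?addr0//.
  move=> k /=; rewrite mem_index_iota => /andP[h _].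
  by rewrite nth_default// scale0r.
split=> [v k x y|u k x y].
  pose N := maxn (size (f (k%:P *: (x : U) + (y : U)))) (maxn (size (f x)) (size (f y))).
  have := actE N (k%:P *: (x : U) + (y : U)) v; rewrite leq_maxl => /(_ isT).
  have := actE N x v; rewrite /N leq_max leq_maxl orbT => /(_ isT).
  have := actE N y v; rewrite /N leq_max leq_maxr orbT => /(_ isT).
  rewrite -/N => ey ex exy; rewrite [LHS]exy.
  rewrite [cdual_act f x v]ex [cdual_act f y v]ey.
  rewrite [X in _ = X + _](_ : _ = k%:P *: act N x v)//.
  rewrite /act scaler_sumr -big_split; apply: eq_bigr => n _ /=.
  rewrite cdual_lin coefD coefZ polyCD scalerDl; congr (_ + _).
  by rewrite polyCM scalerA.
rewrite [X in _ = X + _](_ : _ = k%:P *: cdual_act f u x)//.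
rewrite /cdual_act scaler_sumr -big_split; apply: eq_bigr => n _ /=.
rewrite [X in lamC X](_ : _ = k%:P *: (x : U) + (y : U))//.
have -> : lamC (k%:P *: (x : U) + (y : U)) = k%:P *: lamC (x : U) + lamC (y : U).
  by apply: lpolyP => -[|m]; rewrite lcoefD lcoefZ//= scaler0 addr0.
have -> : iter n (@neglamdel K U) (k%:P *: lamC (x : U) + lamC (y : U)) =
  k%:P *: iter n (@neglamdel K U) (lamC (x : U)) + iter n (@neglamdel K U) (lamC (y : U)).
  by elim: (nat_of_ord n) => //= m ->; rewrite neglamdelD neglamdelZ.
by rewrite scalerDr !scalerA mulrC.
Qed.

Lemma Tlam_sum (I : Type) (s : seq I) (u v : I -> U) (f : cdual U) :
  Tlam (\sum_(i <- s) tens2 (u i) (v i)) f = \sum_(i <- s) cdual_act f (u i) (v i).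
Proof. exact: (tsum_sum _ _ _ (cdual_act_bilin f)). Qed.

Lemma Tzero_sum (I : Type) (s : seq I) (u v : I -> U) (f : cdual U) :
  Tzero (\sum_(i <- s) tens2 (u i) (v i)) f =
  \sum_(i <- s) (f (u i) \Po (- 'X)) *: v i.
Proof.
rewrite /Tzero Tlam_sum (@morphDsum _ _ (fun p : lpoly U => p 0%N))//.
apply: eq_bigr => i _.
rewrite /cdual_act (@morphDsum _ _ (fun p : lpoly U => p 0%N))//.
rewrite comp_polyE scaler_suml; apply: eq_bigr => k _.
rewrite lcoefZ -mul_polyC -scalerA; congr (_ *: _).
elim: (nat_of_ord k) => [|m IH] /=; first by rewrite expr0 scale1r.
have nE (q : lpoly U) : neglamdel q 0%N = - ('X *: q 0%N).
  by rewrite [LHS](_ : _ = - 0 - 'X *: q 0%N)// oppr0 add0r.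
by rewrite [LHS]nE IH exprS mulNr scaleNr scalerA.
Qed.

Lemma dual_basis_exists (n : nat) (e : 'I_n -> U) : cbasis e ->
  exists estar : 'I_n -> cdual U, forall i k, estar i (e k) = (i == k)%:R.
Proof.
move=> [gen free].
have [c cE] := choice gen.
have uniqc (d d' : 'I_n -> {poly K}) :
    \sum_(i < n) d i *: e i = \sum_(i < n) d' i *: e i -> forall i, d i = d' i.
  move=> h i; apply/eqP; rewrite -subr_eq0; apply/eqP.
  apply: (free (fun i => d i - d' i)); rewrite -[RHS](subrr (\sum_(i < n) d i *: e i)).
  by rewrite [in X in _ = _ - X]h -sumrB; apply: eq_bigr => j _; rewrite scalerBl.
have hc i : (fun u => c u i) \in @cdual_pred K U.
  apply/asboolP; split=> [k u v|u].
    rewrite -mul_polyC.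
    apply: (uniqc (c (k%:P *: u + v)) (fun i => k%:P * c u i + c v i)).
    rewrite -cE {1}(cE u) {1}(cE v) scaler_sumr -big_split.
    by apply: eq_bigr => j _; rewrite scalerDl scalerA.
  apply: (uniqc (c ('X *: u)) (fun i => 'X * c u i)).
  rewrite -cE {1}(cE u) scaler_sumr.
  by apply: eq_bigr => j _; rewrite scalerA.
exists (fun i => CDual (hc i)) => i k /=.
apply: (uniqc (c (e k)) (fun i => (i == k)%:R)).
rewrite -cE (bigD1 k)//= eqxx scale1r big1 ?addr0// => j /negbTE ->.
by rewrite scale0r.
Qed.

Lemma cbasis_finite (n : nat) (e : 'I_n -> U) : cbasis e -> cfinite U.
Proof. by case=> gen _; exists n, e. Qed.

End Module.

Section SEquation.
Variable B : lsca K.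

Lemma lbracket_linl k (a a' b : B) :
  lbracket (k%:P *: a + a') b = k%:P *: lbracket a b + lbracket a' b.
Proof.
rewrite /lbracket lscaDl lscaDr lscaZl lscaZr.
have CD : {morph @lamC _ B : u v / u + v}.
  by move=> u v; apply: lpolyP => -[|n]; rewrite lcoefD//= addr0.
rewrite (psubD CD (@neglamdelD B)).
rewrite (psubZ (g := fun p => k%:P *: p) _ CD (@neglamdelD B)).
- by rewrite scalerBr opprD addrACA.
- by move=> p q; rewrite scalerDr.
- by move=> v; apply: lpolyP => -[|n]; rewrite lcoefZ//= scaler0.
- by move=> p; rewrite neglamdelZ.
Qed.

Lemma lbracket_linr k (a b b' : B) :
  lbracket a (k%:P *: b + b') = k%:P *: lbracket a b + lbracket a b'.
Proof.
rewrite /lbracket lscaDl lscaDr lscaZl lscaZr.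
have CD : {morph @lamC _ B : u v / u + v}.
  by move=> u v; apply: lpolyP => -[|n]; rewrite lcoefD//= addr0.
rewrite (psubD CD (@neglamdelD B)).
rewrite (psubZ (g := fun p => k%:P *: p) _ CD (@neglamdelD B)).
- by rewrite scalerBr opprD addrACA.
- by move=> p q; rewrite scalerDr.
- by move=> v; apply: lpolyP => -[|n]; rewrite lcoefZ//= scaler0.
- by move=> p; rewrite neglamdelZ.
Qed.

Let comb (x y z x' y' z' : tensor3 B) (k : K) :
  (k *: x + x') - (k *: y + y') - (k *: z + z') =
  k *: (x - y - z) + (x' - y' - z').
Proof.
by rewrite !scalerBr !opprD [X in X + _ = _]addrACA [LHS]addrACA.
Qed.

Lemma Sterm_bilinj (ri li : B) : bilin (fun rj lj : kmod B => Sterm ri li rj lj).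
Proof.
have l1 := @del1_linear B; have l2 := @del2_linear B.
split=> [lj k x y|rj k x y]; rewrite /Sterm.
- rewrite -comb; congr (_ - _ - _); apply: psub_linf => // c.
  + exact: tens3_lin2.
  + exact: tens3_lin1.
  + exact: tens3_lin2.
- rewrite -comb lscaDl lscaZl lbracket_linr.
  by congr (_ - _ - _); apply: psub_lin => //;
    [exact: tens3_lin1|exact: tens3_lin2|exact: tens3_lin3].
Qed.

Lemma Sterm_bilini (rj lj : B) : bilin (fun ri li : kmod B => Sterm ri li rj lj).
Proof.
have l1 := @del1_linear B; have l2 := @del2_linear B.
split=> [li k x y|ri k x y]; rewrite /Sterm.
- rewrite -comb lscaDr lscaZr; congr (_ - _ - _).
  + by apply: psub_lin => //; exact: tens3_lin1.
  + by apply: psub_lin => //; exact: tens3_lin2.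
  + by apply: psub_linf => // c; exact: tens3_lin1.
- rewrite -comb lbracket_linl; congr (_ - _ - _).
  + by apply: psub_linf => // c; exact: tens3_lin3.
  + by apply: psub_linf => // c; exact: tens3_lin3.
  + by apply: psub_lin => //; exact: tens3_lin3.
Qed.

Lemma Sexpr_sum (I : Type) (s : seq I) (r l : I -> B) :
  Sexpr (\sum_(i <- s) tens2 (r i) (l i)) =
  \sum_(i <- s) \sum_(j <- s) Sterm (r i) (l i) (r j) (l j).
Proof.
have inner (ri li : kmod B) :
    tsum (fun rj lj : kmod B => Sterm ri li rj lj)
      (\sum_(i <- s) tens2 (r i) (l i) : tensor2 B) =
    \sum_(j <- s) Sterm ri li (r j) (l j).
  exact: (tsum_sum _ _ _ (Sterm_bilinj ri li)).
have outer : bilin (fun ri li : kmod B =>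
    tsum (fun rj lj : kmod B => Sterm ri li rj lj)
      (\sum_(i <- s) tens2 (r i) (l i) : tensor2 B)).
  split=> [li k x y|ri k x y]; rewrite !inner scaler_sumr -big_split;
    by apply: eq_bigr => j _; rewrite ?(Sterm_bilini _ _).1 ?(Sterm_bilini _ _).2.
rewrite /Sexpr [LHS](tsum_sum _ _ _ outer).
by apply: eq_bigr => i _; rewrite inner.
Qed.

End SEquation.
End Presentations.

(* Main.v *)
Require Import Defs.
From mathcomp Require Import all_boot all_order all_algebra.
From mathcomp Require Import complex boolp reals.
Local Open Scope ring_scope.

(** The S-equation for [r = \sum_i r_i (x) l_i] follows from an invariance
    property.  Modulo the total [d], the variable [- mu - d] produced by the
    bracket at [mu = d_1] equals [d_2], so the terms of the equation regroup as
<<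
   \sum_j \sum_i (l_j.r_i (x) r_j (x) l_i + r_i (x) r_j (x) l_j.l_i)  at mu = d_2
 - \sum_j r_j (x) \sum_i (l_j.r_i (x) l_i + r_i (x) l_j.l_i)          at mu = d_1
>>
    Each inner sum is the left multiplication by [l_j] on both factors of [r],
    taken at the [d] of the factor that holds [r_j], i.e. at minus the total [d]
    of the two others.  Hence every tensor invariant under left multiplications
    is a solution ([S_equation_of_invariant]).

    The canonical tensor [\sum_i (e_i (x) e*_i + e*_i (x) e_i)] is invariant:
    elements of [A^{*c}] multiply to zero from the left, and an element of [A]
    acts on [A^{*c}] by minus the transpose of its action on [A], so that the two
    contributions to [\sum_i e_i (x) e*_i] cancel ([dual_pair_invariant],
    [canonical_invariant]).  This cancellation compares a matrix of polynomials in
    [lambda] and [d] with its transpose ([Ldual_basis]).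

    Symmetry is visible on the formula, and [T_0] is inverted by the pairing
    between [A] and [A^{*c}], extended symmetrically to [A (+) A^{*c}]
    ([canonical_nondegenerate]). *)

Set Implicit Arguments.
Unset Strict Implicit.
Unset Printing Implicit Defensive.
Import GRing.Theory Num.Theory.

(** * Polynomials evaluated at an operator *)

Section OperatorPolynomials.
Variables (K : fieldType) (W : lmodType K).
Implicit Types (p q : {poly K}) (T : W -> W) (w : W).

(** The vector [p(T) w] for a bare function [T]: the operators below act on
    tensors and on [lambda]-polynomials over a mere vector space, where [p]
    cannot act as a scalar. *)
Definition opeval p T w : W := \sum_(m < size p) p`_m *: iter m T w.

Lemma opevalE N p T w : (size p <= N)%N ->
  opeval p T w = \sum_(m < N) p`_m *: iter m T w.
Proof.
move=> le; rewrite /opeval (big_ord_widen _ (fun m => p`_m *: iter m T w) le).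
rewrite [RHS](bigID (fun m : 'I_N => (m < size p)%N)) /= [X in _ + X]big1 ?addr0//.
by move=> m; rewrite -leqNgt => h; rewrite nth_default// scale0r.
Qed.

Lemma opevalD p q T w : opeval (p + q) T w = opeval p T w + opeval q T w.
Proof.
rewrite (opevalE _ _ (size_polyD p q)) (opevalE _ _ (leq_maxl _ (size q))).
rewrite (opevalE _ _ (leq_maxr (size p) _)) -big_split.
by apply: eq_bigr => m _; rewrite coefD scalerDl.
Qed.

Lemma opevalZ k p T w : opeval (k *: p) T w = k *: opeval p T w.
Proof.
rewrite (opevalE _ _ (size_scale_leq k p)) scaler_sumr.
by apply: eq_bigr => m _; rewrite coefZ scalerA.
Qed.

End OperatorPolynomials.

Lemma opeval_comp (K : fieldType) (W W' : lmodType K) (g : W -> W') p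
    (T : W -> W) (T' : W' -> W') w :
  linear g -> (forall w, g (T w) = T' (g w)) ->
  g (opeval p T w) = opeval p T' (g w).
Proof.
move=> gl gT; have gD : {morph g : x y / x + y}.
  by move=> x y; have := gl 1 x y; rewrite !scale1r.
rewrite /opeval (morphDsum _ _ gD); apply: eq_bigr => m _.
have -> : g (p`_m *: iter m T w) = p`_m *: g (iter m T w).
  by have := gl p`_m (iter m T w) 0; rewrite (morphD0 gD) !addr0.
by congr (_ *: _); elim: (nat_of_ord m) => //= j <-.
Qed.

Lemma opeval_mul (K : fieldType) (V : lmodType {poly K}) (p q : {poly K})
    (v : kmod V) :
  opeval p (fun u : kmod V => q *: (u : V)) v = (p \Po q) *: (v : V).
Proof.
rewrite comp_polyE scaler_suml; apply: eq_bigr => m _.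
rewrite -mul_polyC -scalerA; congr (_ *: _).
elim: (nat_of_ord m) => [|j IH] /=; first by rewrite expr0 scale1r.
by rewrite exprS -scalerA -IH.
Qed.

(** * Congruence modulo the image of an operator *)

Section Congruence.
Variables (K : numFieldType) (W : lmodType K) (D : W -> W).
Hypothesis D_lin : linear D.

Definition eqmod (x y : W) : Prop := exists t, x - y = D t.

Let DD : {morph D : x y / x + y} := linD D_lin.

Lemma eqmod_refl x : eqmod x x.
Proof. by exists 0; rewrite subrr (morphD0 DD). Qed.

Lemma eqmod_trans y x z : eqmod x y -> eqmod y z -> eqmod x z.
Proof.
by move=> [s hs] [t ht]; exists (s + t); rewrite DD -hs -ht addrA subrK.
Qed.

Lemma eqmodD x y x' y' : eqmod x y -> eqmod x' y' -> eqmod (x + x') (y + y').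
Proof.
by move=> [s hs] [t ht]; exists (s + t); rewrite DD -hs -ht opprD addrACA.
Qed.

Lemma eqmodN x y : eqmod x y -> eqmod (- x) (- y).
Proof. by move=> [s hs]; exists (- s); rewrite (morphDN DD) -hs opprD. Qed.

Lemma eqmodZ k x y : eqmod x y -> eqmod (k *: x) (k *: y).
Proof. by move=> [s hs]; exists (k *: s); rewrite (linZ D_lin) -hs scalerBr. Qed.

Lemma eqmod_sum (I : Type) (s : seq I) (F G : I -> W) :
  (forall i, eqmod (F i) (G i)) ->
  eqmod (\sum_(i <- s) F i) (\sum_(i <- s) G i).
Proof.
by move=> h; apply: (big_ind2 eqmod) => *; [exact: eqmod_refl|exact: eqmodD|].
Qed.

Variables (T T' : W -> W).
Hypotheses (T_add : {morph T : x y / x + y}) (TDC : forall w, T (D w) = D (T w)).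
Hypothesis TT' : forall w, eqmod (T w) (T' w).

(** Substituting congruent operators gives congruent results, provided that
    the first operator preserves the image of [D]; this is how [- S - Q] gets
    replaced by [P] when [P + Q + S] vanishes. *)
Lemma eqmod_iter n x y : eqmod x y -> eqmod (iter n T x) (iter n T' y).
Proof.
move=> xy; elim: n => //= n [t ht].
apply: eqmod_trans (TT' _); exists (T t).
by rewrite -TDC -ht T_add (morphDN T_add).
Qed.

Lemma eqmod_opeval p w : eqmod (opeval p T w) (opeval p T' w).
Proof.
by apply: eqmod_sum => m; apply: eqmodZ; apply: eqmod_iter; exact: eqmod_refl.
Qed.

Lemma eqmod_psub (V : lmodType {poly K}) (f g : V -> W) (p : lpoly V) :
  (forall v, eqmod (f v) (g v)) -> eqmod (psub f T p) (psub g T' p).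
Proof. by move=> fg; apply: eqmod_sum => m; apply: eqmod_iter. Qed.

End Congruence.

(** * Dual bases *)

Section DualBasis.
Variables (K : fieldType) (U : lmodType {poly K}) (n : nat).
Variables (e : 'I_n -> U) (estar : 'I_n -> cdual U).
Hypothesis e_basis : cbasis e.
Hypothesis estar_dual : forall i k : 'I_n, estar i (e k) = (i == k)%:R.

Lemma dual_basis_expand u : u = \sum_(i < n) estar i u *: e i.
Proof.
have [c cE] := e_basis.1 u; rewrite {1}cE; apply: eq_bigr => i _; congr (_ *: _).
rewrite cE (morphDsum _ _ (cdualD _)) (bigD1 i)//= big1 => [|k /negbTE ki].
  by rewrite cdual_poly estar_dual eqxx mulr1 addr0.
by rewrite cdual_poly estar_dual eq_sym ki mulr0.
Qed.

(** The coordinates are twisted by [- 'X] because [d] acts on the dual by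
    [- lambda]: evaluating at [e k] undoes the twist. *)
Lemma cdual_expand (f : cdual U) :
  f = \sum_(k < n) (f (e k) \Po (- 'X)) *: estar k.
Proof.
apply: cdualP => u; rewrite {1}(dual_basis_expand u) (morphDsum _ _ (cdualD _)).
rewrite (@morphDsum _ _ (fun g : cdual U => g u))//.
apply: eq_bigr => k _; rewrite cdual_poly cdualZE -comp_polyA.
by rewrite raddfN /= comp_polyX opprK comp_polyXr mulrC.
Qed.
End DualBasis.

(** * The dual action in coordinates *)

Section CotangentAction.
Variables (K : numFieldType) (A : lsca K) (Afin : cfinite A) (n : nat).
Variables (e : 'I_n -> A) (estar : 'I_n -> cdual A).
Hypothesis e_basis : cbasis e.
Hypothesis estar_dual : forall i k : 'I_n, estar i (e k) = (i == k)%:R.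

Lemma kmod_leval_linear (V : lmodType {poly K}) (x : K) :
  linear (@leval K V x : kmod (lpoly V) -> kmod V).
Proof.
by move=> k p q; rewrite levalD; congr (_ + _); exact: (levalZ x k%:P p).
Qed.

Lemma leval_opeval (V : lmodType {poly K}) (x : K) (p : {poly K}) (v : V) :
  leval x (opeval p (@neglamdel K V : kmod (lpoly V) -> kmod (lpoly V))
             (lamC v))
  = (p \Po (- x%:P - 'X)) *: v.
Proof.
rewrite (opeval_comp (T' := fun u : kmod V => (- x%:P - 'X) *: (u : V)) p _
  (@kmod_leval_linear V x)) => [|q].
  by rewrite leval_lamC; exact: opeval_mul.
by rewrite levalD !levalN leval_lamX levalZ scalerBl scaleNr.
Qed.

(** If [a_lambda e_k = \sum_i P_ik(lambda, d) e_i], then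
    [L^*(a)_lambda e*_i = - \sum_k P_ik(lambda, - lambda - d) e*_k].  This is
    the transposition rule, written for any [f] in place of [e*_i].  It is
    proved at scalar values of [lambda], but stated on [lambda]-polynomials, so
    that an operator can be substituted for [lambda] afterwards. *)
Lemma Ldual_basis (a : A) (f : cdual A) :
  Ldual a f Afin = - \sum_(k < n)
    psub (fun c => opeval (f c)
            (@neglamdel K (cdual A) : kmod (lpoly _) -> kmod (lpoly _))
            (lamC (estar k)) : lpoly (cdual A))
         (@lamX _ (cdual A)) (lprod a (e k)).
Proof.
apply: levalP => x; rewrite levalN (morphDsum _ _ (levalD x)).
rewrite [LHS](cdual_expand e_basis estar_dual) -sumrN; apply: eq_bigr => k _.
rewrite (psub_comp (T' := fun v => x%:P *: v) _ _ (levalD x) (leval_lamX x)).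
rewrite leval_Ldual.
rewrite (@eq_psub _ _ _ _
  (fun c => (f c \Po (- x%:P - 'X)) *: estar k) _ (fun v => x%:P *: v)) //; last first.
  by move=> c /=; exact: leval_opeval.
rewrite (leval_psub (x := x)
  (f := fun c => (f c \Po (- x%:P - 'X)) *: estar k)) => [|u v|v].
- by rewrite raddfN /= -comp_polyA comp_polyB comp_polyX comp_polyC scaleNr addrC.
- by rewrite cdualD comp_polyD scalerDl.
- by rewrite cdualC comp_polyM comp_polyC scalerA.
Qed.

End CotangentAction.

(** * Invariance of the pairing between the algebra and its dual *)

Section Slots.
Variables (K : numFieldType) (W : lmodType K).
Variables (D P Q S : W -> W).

(** A bilinear map that carries [d] on its two arguments to the commuting
    operators [P] and [Q], with a third operator [S] such that [P + Q + S = D].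
    The model is the insertion of two vectors next to a fixed one in a triple
    tensor product, [S] being [d] on the fixed factor and [D] the total [d];
    working with an abstract [Phi] treats all positions of the factors at
    once. *)
Record slots (V1 V2 : lmodType {poly K}) (Phi : V1 -> V2 -> W) : Prop := Slots {
  slots_bilin : bilin (Phi : kmod V1 -> kmod V2 -> W);
  slots_X1 : forall u v, Phi ('X *: u) v = P (Phi u v);
  slots_X2 : forall u v, Phi u ('X *: v) = Q (Phi u v);
  slots_lin1 : linear P;
  slots_lin2 : linear Q;
  slots_linS : linear S;
  slots_PQ : forall w, P (Q w) = Q (P w);
  slots_PS : forall w, P (S w) = S (P w);
  slots_QS : forall w, Q (S w) = S (Q w);
  slots_total : forall w, D w = P w + Q w + S w }.

Section SlotTheory.
Variables (V1 V2 : lmodType {poly K}) (Phi : V1 -> V2 -> W).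
Hypothesis slotsPhi : slots Phi.

Lemma total_linear : linear D.
Proof.
case: slotsPhi => _ _ _ Pl Ql Sl _ _ _ DE k x y.
by rewrite !DE Pl Ql Sl !scalerDr [X in X + _ = _]addrACA [LHS]addrACA.
Qed.

Lemma opeval_slot1 (p : {poly K}) u f : Phi (p *: u) f = opeval p P (Phi u f).
Proof.
case: slotsPhi => -[Phil _] PX _ _ _ _ _ _ _ _.
have {1}-> : p *: u = opeval p (fun v : kmod V1 => 'X *: (v : V1)) u.
  by rewrite opeval_mul comp_polyXr.
by rewrite (opeval_comp (T' := P) _ _ (Phil f)) // => w; exact: PX.
Qed.

Lemma psub_slot2 u f (p : {poly K}) :
  psub (Phi u) S (opeval p
    (@neglamdel K V2 : kmod (lpoly _) -> kmod (lpoly _)) (lamC f))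
  = opeval p (fun w => - S w - Q w) (Phi u f).
Proof.
case: slotsPhi => -[Phil Phir] _ QX _ Ql Sl _ _ QS _.
have SD := linD Sl; have QD := linD Ql; have PhiD : {morph Phi u : x y / x + y} := linD (Phir u).
rewrite (opeval_comp (g := psub (Phi u) S) (W := kmod (lpoly V2))
   p (T' := fun w => - S w - Q w)).
- by rewrite psub_lamC.
- by move=> k q q'; exact: psub_lin (Phir u) Sl.
- move=> q; rewrite (psubD PhiD SD) !(morphDN (psubD PhiD SD)) psub_lamX//.
  by rewrite (psubZ (g := Q) _ PhiD SD QD) // => v; exact: QX.
Qed.

End SlotTheory.

Section DualPair.
Variables (A : lsca K) (Afin : cfinite A) (n : nat).
Variables (e : 'I_n -> A) (estar : 'I_n -> cdual A).
Hypothesis e_basis : cbasis e.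
Hypothesis estar_dual : forall i k : 'I_n, estar i (e k) = (i == k)%:R.
Variable (Phi : A -> cdual A -> W).
Hypothesis slotsPhi : slots Phi.

(** By [Ldual_basis] the second sum is minus the sum over [i, k] of
    [P_ik(S, - S - Q)] applied to [Phi (e_i) (e*_k)].  Expanding [a_lambda e_k] in
    the basis turns the first one into the sum of [P_ik(S, P)] applied to the same
    vectors, and [P = - S - Q] modulo [D].  In other words, the two actions of [a]
    on [\sum_i e_i (x) e*_i] cancel when [lambda] is minus the total [d]. *)
Lemma dual_pair_invariant (a : A) :
  eqmod D (\sum_(i < n) (psub (Phi^~ (estar i)) S (lprod a (e i))
                       + psub (Phi (e i)) S (Ldual a (estar i) Afin))) 0.
Proof.
have Dl := total_linear slotsPhi.
case: slotsPhi => -[Phil Phir] PX QX Pl Ql Sl PQ PS QS DE.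
have SD := linD Sl; have PD := linD Pl; have QD := linD Ql; have DD := linD Dl.
pose F i k (T : W -> W) c := opeval (estar i c) T (Phi (e i) (estar k)).
have E1 i : psub (Phi (e i)) S (Ldual a (estar i) Afin) =
    - \sum_(k < n) psub (F i k (fun w => - S w - Q w)) S (lprod a (e k)).
  rewrite (Ldual_basis Afin e_basis estar_dual).
  have PhiD : {morph Phi (e i) : x y / x + y} := linD (Phir (e i)).
  have gD := psubD PhiD SD.
  rewrite (morphDN gD) (morphDsum _ _ gD); congr (- _); apply: eq_bigr => k _.
  rewrite (psub_comp (T' := S) _ _ gD) => [|w]; last first.
    by rewrite psub_lamX.
  by apply: eq_psub => // c /=; exact: (psub_slot2 slotsPhi).
(* each coefficient of [a_lambda e_k] is expanded in the basis [e] *)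
have E2 : \sum_(i < n) psub (Phi^~ (estar i)) S (lprod a (e i)) =
    \sum_(i < n) \sum_(k < n) psub (F i k P) S (lprod a (e k)).
  rewrite exchange_big; apply: eq_bigr => k _.
  rewrite /psub exchange_big; apply: eq_bigr => m _ /=.
  rewrite -(morphDsum _ _ (iter_morphD SD m)); congr (iter _ _ _).
  rewrite {1}(dual_basis_expand e_basis estar_dual (lprod a (e k) m)).
  rewrite (morphDsum _ _ (linD (Phil (estar k)))).
  by apply: eq_bigr => i _; exact: (opeval_slot1 slotsPhi).
rewrite big_split E2 (eq_bigr _ (fun i _ => E1 i)) sumrN.
rewrite -[X in eqmod _ _ X](subrr (\sum_(i < n) \sum_(k < n) psub (F i k P) S (lprod a (e k)))).
apply: (eqmodD Dl); first exact: eqmod_refl.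
apply: (eqmodN Dl); apply: (eqmod_sum Dl) => i; apply: (eqmod_sum Dl) => k.
have SDC w : S (D w) = D (S w) by rewrite !DE !SD PS QS.
apply: eqmod_psub => // [w|c]; first exact: eqmod_refl.
apply: eqmod_opeval => // [x y|w|w].
- by rewrite SD QD !opprD addrACA.
- rewrite SDC DD !(morphDN DD); congr (_ - _).
  by rewrite !DE !QD PQ QS.
(* [- S - Q = P - D] *)
- by exists (- w); rewrite (morphDN DD) DE !opprD [LHS]addrC [X in _ + X = _]addrC addrA.
Qed.

End DualPair.
End Slots.

(** * Invariant tensors solve the conformal S-equation *)

Section SEquationFromInvariance.
Variables (K : numFieldType).

(** The tensor [\sum_p r_p (x) l_p] is killed by left multiplications
    [b_lambda] with [lambda] equal to minus the total [d].  As this substitution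
    makes no sense in [B (x) B] modulo the total [d], the two factors are placed
    next to a third slot whose operator [S] provides [lambda]. *)
Definition left_invariant (B : lsca K) (I : finType) (r l : I -> B) : Prop :=
  forall (W : lmodType K) (D P Q S : W -> W) (Psi : B -> B -> W),
    slots D P Q S Psi -> forall b : B,
    eqmod D (\sum_p (psub (Psi^~ (l p)) S (lprod b (r p))
                   + psub (Psi (r p)) S (lprod b (l p)))) 0.

Lemma eq_linear_tens3 (U : lmodType {poly K}) (W : lmodType K)
    (f g : tensor3 U -> W) : linear f -> linear g ->
  (forall u v w, f (tens3 u v w) = g (tens3 u v w)) -> f =1 g.
Proof.
move=> fl gl fg t; rewrite (tensorE t).
rewrite (morphDsum _ _ (linD fl)) (morphDsum _ _ (linD gl)).
apply: eq_bigr => -[t2 w] _ /=; rewrite (tensorE t2).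
have tD := bilinDl (tens_bilin (tensor2 U) (kmod U)) w.
rewrite (morphDsum _ _ tD) (morphDsum _ _ (linD fl)) (morphDsum _ _ (linD gl)).
by apply: eq_bigr => -[u v] _; exact: fg.
Qed.

Variable B : lsca K.

Let D (t : tensor3 B) := del1 t + del2 t + del3 t.

Lemma linear_compose (V1 V2 V3 : lmodType K) (f : V2 -> V3) (g : V1 -> V2) :
  linear f -> linear g -> linear (fun x => f (g x)).
Proof. by move=> fl gl k x y; rewrite gl fl. Qed.

Lemma del1_del2C (t : tensor3 B) : del1 (del2 t) = del2 (del1 t).
Proof.
apply: (eq_linear_tens3 (f := fun t => del1 (del2 t)) (g := fun t => del2 (del1 t))).
- exact: linear_compose (@del1_linear _ _) (@del2_linear _ _).
- exact: linear_compose (@del2_linear _ _) (@del1_linear _ _).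
- by move=> u v w; rewrite del2_tens !del1_tens del2_tens.
Qed.

Lemma del1_del3C (t : tensor3 B) : del1 (del3 t) = del3 (del1 t).
Proof.
apply: (eq_linear_tens3 (f := fun t => del1 (del3 t)) (g := fun t => del3 (del1 t))).
- exact: linear_compose (@del1_linear _ _) (@del3_linear _ _).
- exact: linear_compose (@del3_linear _ _) (@del1_linear _ _).
- by move=> u v w; rewrite del3_tens !del1_tens del3_tens.
Qed.

Lemma del2_del3C (t : tensor3 B) : del2 (del3 t) = del3 (del2 t).
Proof.
apply: (eq_linear_tens3 (f := fun t => del2 (del3 t)) (g := fun t => del3 (del2 t))).
- exact: linear_compose (@del2_linear _ _) (@del3_linear _ _).
- exact: linear_compose (@del3_linear _ _) (@del2_linear _ _).
- by move=> u v w; rewrite del3_tens !del2_tens del3_tens.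
Qed.

(** The two ways of inserting a pair around the fixed vector [w] that occur in
    the S-equation. *)
Lemma slots_tens3_13 (w : B) :
  slots D (@del1 K B) (@del3 K B) (@del2 K B) (fun u v => tens3 u w v).
Proof.
split; try exact: del1_linear; try exact: del2_linear; try exact: del3_linear.
- by split=> [v|u]; [exact: tens3_lin1|exact: tens3_lin3].
- by move=> u v; rewrite del1_tens.
- by move=> u v; rewrite del3_tens.
- exact: del1_del3C.
- exact: del1_del2C.
- by move=> t; rewrite del2_del3C.
- by move=> t; rewrite /D addrAC.
Qed.

Lemma slots_tens3_23 (w : B) :
  slots D (@del2 K B) (@del3 K B) (@del1 K B) (fun u v => tens3 w u v).
Proof.
split; try exact: del1_linear; try exact: del2_linear; try exact: del3_linear.
- by split=> [v|u]; [exact: tens3_lin2|exact: tens3_lin3].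
- by move=> u v; rewrite del2_tens.
- by move=> u v; rewrite del3_tens.
- exact: del2_del3C.
- by move=> t; rewrite del1_del2C.
- by move=> t; rewrite del1_del3C.
- by move=> t; rewrite /D -addrA addrC.
Qed.

(** The bracket contributes [l_i_mu l_j] with [mu = d_1], and
    [l_j_{- mu - d} l_i] with [- mu - d = - d_1 - d_3], which is [d_2] modulo the
    total [d].  The terms substituted with [d_2] are grouped, as are those with
    [d_1]. *)
Lemma Sterm_eqmod (ri li rj lj : B) :
  eqmod D (Sterm ri li rj lj)
    ((psub (fun c => tens3 c rj li) (@del2 K B) (lprod lj ri)
      + psub (fun c => tens3 ri rj c) (@del2 K B) (lprod lj li))
     - (psub (fun c => tens3 rj c li) (@del1 K B) (lprod lj ri)
        + psub (fun c => tens3 ri rj c) (@del1 K B) (lprod li lj))).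
Proof.
have Dl := total_linear (slots_tens3_13 0).
have d1D := linD (@del1_linear K B); have d3D := linD (@del3_linear K B).
have tD : {morph (fun c : B => tens3 ri rj c) : x y / x + y}.
  exact: linD (tens3_lin3 ri rj).
have gD := psubD tD d1D.
rewrite /Sterm.
have -> : psub (fun c => tens3 ri rj c) (@del1 K B) (lbracket li lj) =
    psub (fun c => tens3 ri rj c) (@del1 K B) (lprod li lj)
    - psub (fun c => tens3 ri rj c) (fun t => - del1 t - del3 t) (lprod lj li).
  rewrite /lbracket gD (morphDN gD); congr (_ - _).
  rewrite (psub_comp (T' := fun t => - del1 t - del3 t) _ _ gD) => [|q].
    by apply: eq_psub => // c /=; exact: psub_lamC.
  rewrite /neglamdel gD !(morphDN gD) psub_lamX //; congr (_ - _).
  by rewrite (psubZ (g := @del3 K B) _ tD d1D d3D) // => [v|t];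
    [rewrite del3_tens|rewrite del1_del3C].
set a1 := psub _ _ _; set a2 := psub _ _ _; set a3 := psub _ _ (lprod li lj).
set x := psub _ _ _; set y := psub _ _ _.
have -> : a1 - a2 - (a3 - x) = (a1 + x) - (a2 + a3).
  by rewrite !opprD opprK addrA -!addrA; congr (_ + _); rewrite addrA addrC.
apply: (eqmodD Dl); last exact: eqmod_refl.
apply: (eqmodD Dl); first exact: eqmod_refl.
apply: eqmod_psub => // [u v|t|t|c]; last exact: eqmod_refl.
- by rewrite d1D d3D !opprD addrACA.
- have DD := linD Dl; rewrite DD !(morphDN DD); congr (- _ - _).
    by rewrite /D !d1D del1_del2C del1_del3C.
  by rewrite /D !d3D -del1_del3C -del2_del3C.
- exists (- t); rewrite (morphDN (linD Dl)) /D !opprD.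
  by rewrite [LHS]addrAC.
Qed.

(** After the two indices are exchanged in the term of [l_i_mu l_j], both groups
    of [Sterm_eqmod], summed over [i], say that [l_j] acts on the invariant tensor
    [\sum_i r_i (x) l_i], placed in the factors 1, 3 for the first group and 2, 3
    for the second. *)
Lemma S_equation_of_invariant (I : finType) (r l : I -> B) :
  left_invariant r l ->
  conformal_S_equation (\sum_p tens2 (r p) (l p)).
Proof.
move=> inv; have Dl := total_linear (slots_tens3_13 0).
suff [t ht] : eqmod D (Sexpr (\sum_p tens2 (r p) (l p))) 0.
  by exists t; rewrite -[RHS]ht subr0.
rewrite Sexpr_sum.
pose F i j := psub (fun c => tens3 c (r j) (l i)) (@del2 K B) (lprod (l j) (r i))
      + psub (fun c => tens3 (r i) (r j) c) (@del2 K B) (lprod (l j) (l i)).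
pose G i j := psub (fun c => tens3 (r j) c (l i)) (@del1 K B) (lprod (l j) (r i)).
pose H i j := psub (fun c => tens3 (r i) (r j) c) (@del1 K B) (lprod (l i) (l j)).
apply: (eqmod_trans Dl (y := \sum_i \sum_j (F i j - (G i j + H i j)))).
  by apply: (eqmod_sum Dl) => i; apply: (eqmod_sum Dl) => j; exact: Sterm_eqmod.
have -> : \sum_i \sum_j (F i j - (G i j + H i j)) =
    \sum_j ((\sum_i F i j) - \sum_i (G i j + H j i)).
  transitivity (\sum_i \sum_j F i j - (\sum_i \sum_j G i j + \sum_i \sum_j H i j)).
    rewrite -big_split -sumrB; apply: eq_bigr => i _.
    by rewrite -big_split -sumrB.
  rewrite [X in X - _]exchange_big [X in _ - (X + _)]exchange_big.
  rewrite -big_split -sumrB; apply: eq_bigr => j _.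
  by rewrite -big_split.
apply: (eqmod_trans Dl (y := \sum_(j : I) 0)); last first.
  by rewrite big1_eq; exact: eqmod_refl.
apply: (eqmod_sum Dl) => j; rewrite -[X in eqmod _ _ X](subrr 0).
apply: (eqmodD Dl); last apply: (eqmodN Dl).
- exact: (inv _ _ _ _ _ _ (slots_tens3_13 (r j))).
- exact: (inv _ _ _ _ _ _ (slots_tens3_23 (r j))).
Qed.

End SEquationFromInvariance.

(** * The canonical tensor of the semidirect product *)

Section Nondegeneracy.
Variables (K : numFieldType).

Lemma Tzero_linear (U : lmodType {poly K}) (t : tensor2 U) : linear (Tzero t).
Proof.
move=> p f g; have E h : Tzero t h = \sum_(q <- repr t) (h q.1 \Po (- 'X)) *: q.2.
  by rewrite {1}(tensorE t); exact: Tzero_sum.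
rewrite !E scaler_sumr -big_split; apply: eq_bigr => q _.
transitivity ((((p \Po (- 'X)) * f q.1 + g q.1) \Po (- 'X)) *: (q.2 : U)) => //=.
rewrite comp_polyD comp_polyM -comp_polyA.
by rewrite raddfN /= comp_polyX opprK comp_polyXr scalerDl scalerA.
Qed.

End Nondegeneracy.

Section SemidirectCanonical.
Variables (K : numFieldType) (A : lsca K) (Afin : cfinite A) (n : nat).
Variables (e : 'I_n -> A) (estar : 'I_n -> cdual A).
Hypothesis e_basis : cbasis e.
Hypothesis estar_dual : forall i k : 'I_n, estar i (e k) = (i == k)%:R.

Let B : lsca K := semidirect Afin.

Definition canonical_left (p : bool * 'I_n) : B :=
  if p.1 then (e p.2, 0) else (0, estar p.2).
Definition canonical_right (p : bool * 'I_n) : B :=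
  if p.1 then (0, estar p.2) else (e p.2, 0).

Lemma sum_bool_pair (W : zmodType) (F : bool * 'I_n -> W) :
  \sum_p F p = \sum_(i < n) (F (true, i) + F (false, i)).
Proof.
transitivity (\sum_(b : bool) \sum_(i < n) F (b, i)).
  by rewrite pair_bigA; apply: eq_bigr => -[].
by rewrite big_bool big_split.
Qed.

Lemma canonical_tensorE :
  \sum_p tens2 (canonical_left p) (canonical_right p) =
  \sum_(i < n) (tens2 ((e i, 0) : B) ((0, estar i) : B)
                + tens2 ((0, estar i) : B) ((e i, 0) : B)).
Proof. exact: sum_bool_pair. Qed.

Lemma psub0 (V : lmodType {poly K}) (W : zmodType) (f : V -> W) (T : W -> W) :
  psub f T 0 = 0.
Proof.
have : (lsize (0%R : lpoly V) <= 0)%N by exact: lsize_min.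
by rewrite leqn0 /psub => /eqP ->; rewrite big_ord0.
Qed.

Lemma psub_lpair (V1 V2 : lmodType {poly K}) (W : zmodType)
    (f : (V1 * V2)%type -> W) (T : W -> W) (p : lpoly V1) (q : lpoly V2) :
  {morph f : x y / x + y} -> {morph T : x y / x + y} ->
  psub f T (lpair p q) =
  psub (fun u => f (u, 0)) T p + psub (fun v => f (0, v)) T q.
Proof.
move=> fD TD; pose N := maxn (lsize p) (lsize q).
have hp m : (N <= m)%N -> p m = 0 by rewrite geq_max => /andP[/lsizeP].
have hq m : (N <= m)%N -> q m = 0 by rewrite geq_max => /andP[_ /lsizeP].
have f1D : {morph (fun u => f (u, 0)) : x y / x + y}.
  by move=> x y; rewrite -fD; congr f; congr pair; rewrite addr0.
have f2D : {morph (fun v => f (0, v)) : x y / x + y}.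
  by move=> x y; rewrite -fD; congr f; congr pair; rewrite addr0.
rewrite (psubE f1D TD hp) (psubE f2D TD hq) (psubE fD TD (N := N)) => [|m hm].
  rewrite -big_split; apply: eq_bigr => m _ /=.
  rewrite -(iter_morphD TD) -fD; congr (iter _ _ (f _)).
  by congr pair; rewrite ?addr0 ?add0r.
by rewrite /= hp ?hq.
Qed.

Lemma lprod0r (a : A) : lprod a 0 = 0.
Proof. exact: morphD0 (lscaDr a). Qed.

Lemma Ldual0 (a : A) : Ldual a 0 Afin = 0.
Proof.
apply: levalP => x; apply: cdualP => b.
rewrite leval_Ldual [X in X \Po _](_ : _ = 0) // comp_poly0 oppr0.
by rewrite (morphD0 (levalD x)).
Qed.

Lemma psub_semidirect1 (W : zmodType) (f : B -> W) (T : W -> W) (b : B) (u : A) :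
  {morph f : x y / x + y} -> {morph T : x y / x + y} ->
  psub f T (lprod b ((u, 0) : B)) = psub (fun c => f (c, 0)) T (lprod b.1 u).
Proof.
by move=> fD TD; rewrite [LHS](psub_lpair _ _ fD TD) Ldual0 psub0 addr0.
Qed.

Lemma psub_semidirect2 (W : zmodType) (f : B -> W) (T : W -> W) (b : B)
    (h : cdual A) :
  {morph f : x y / x + y} -> {morph T : x y / x + y} ->
  psub f T (lprod b ((0, h) : B)) =
  psub (fun c => f (0, c)) T (Ldual b.1 h Afin).
Proof.
by move=> fD TD; rewrite [LHS](psub_lpair _ _ fD TD) lprod0r psub0 add0r.
Qed.

Lemma slots_swap (W : lmodType K) (D P Q S : W -> W)
    (V1 V2 : lmodType {poly K}) (Phi : V1 -> V2 -> W) :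
  slots D P Q S Phi -> slots D Q P S (fun v u => Phi u v).
Proof.
case=> -[Phil Phir] PX QX Pl Ql Sl PQ PS QS DE; split=> //.
by move=> w; rewrite DE [X in X + _ = _]addrC.
Qed.

Lemma slots_semidirect (W : lmodType K) (D P Q S : W -> W) (Psi : B -> B -> W) :
  slots D P Q S Psi ->
  slots D P Q S (fun (u : A) (f : cdual A) => Psi (u, 0) (0, f)).
Proof.
case=> -[Psil Psir] PX QX Pl Ql Sl PQ PS QS DE; split=> //.
- have zA k : (0 : A) = k%:P *: 0 + 0 by rewrite scaler0 addr0.
  have zf k : (0 : cdual A) = k%:P *: 0 + 0 by rewrite scaler0 addr0.
  split=> [f k u v|u k f g]; [rewrite -Psil|rewrite -Psir];
    by congr (Psi _ _); congr pair; (exact: zf || exact: zA).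
- by move=> u f; rewrite -PX; congr (Psi _ _); congr pair; rewrite scaler0.
- by move=> u f; rewrite -QX; congr (Psi _ _); congr pair; rewrite scaler0.
Qed.

(** The factors in [A^{*c}] multiply everything to zero from the left, so only
    the component of [b] in [A] acts; it acts by left multiplication and by its
    dual, which are transposed to each other.  Both halves of the tensor are thus
    instances of [dual_pair_invariant]. *)
Lemma canonical_invariant : left_invariant canonical_left canonical_right.
Proof.
move=> W D P Q S Psi sl b; rewrite sum_bool_pair.
have Dl := total_linear sl.
have [bl _ _ _ _ Sl _ _ _ _] := sl; have SD := linD Sl.
have Psil v : {morph Psi^~ v : x y / x + y} := bilinDl bl v.
have Psir u : {morph Psi u : x y / x + y} := bilinDr bl u.
rewrite /canonical_left /canonical_right /=.
rewrite (eq_bigr (fun i =>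
   (psub (fun c => Psi (c, 0) (0, estar i)) S (lprod b.1 (e i))
    + psub (fun f => Psi (e i, 0) (0, f)) S (Ldual b.1 (estar i) Afin))
 + (psub (fun c => Psi (0, estar i) (c, 0)) S (lprod b.1 (e i))
    + psub (fun f => Psi (0, f) (e i, 0)) S (Ldual b.1 (estar i) Afin))));
  last first.
  move=> i _; rewrite !psub_semidirect1 // !psub_semidirect2 //.
  by congr (_ + _); exact: addrC.
rewrite big_split -[X in eqmod _ _ X](addr0 0).
apply: (eqmodD Dl).
  exact: (dual_pair_invariant Afin e_basis estar_dual (slots_semidirect sl)).
exact: (dual_pair_invariant Afin e_basis estar_dual
  (slots_semidirect (slots_swap sl))).
Qed.

(** The natural pairing of [A (+) A^{*c}] with itself; the substitution of [- 'X]
    makes the evaluation of [v.2] at a fixed vector conformal linear in [v.2]. *)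
Fact canonical_form_subproof (b : B) :
  (fun v : B => b.2 v.1 + (v.2 b.1 \Po (- 'X))) \in @cdual_pred K B.
Proof.
apply/asboolP; split=> [k u v|u] /=.
  rewrite cdual_lin.
  rewrite [X in X \Po _](_ : _ = (k%:P \Po (- 'X)) * u.2 b.1 + v.2 b.1) //.
  by rewrite comp_polyC comp_polyD comp_polyM comp_polyC mul_polyC scalerDr addrACA.
rewrite cdualX [X in X \Po _](_ : _ = ('X \Po (- 'X)) * u.2 b.1) //.
by rewrite comp_polyX comp_polyM raddfN /= comp_polyX opprK mulrDr.
Qed.

Definition canonical_form (b : B) : cdual B := CDual (canonical_form_subproof b).

Let r : tensor2 B := \sum_p tens2 (canonical_left p) (canonical_right p).

Lemma Tzero_canonical (f : cdual B) :
  Tzero r f = (\sum_(i < n) (f (0, estar i) \Po (- 'X)) *: e i,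
               \sum_(i < n) (f (e i, 0) \Po (- 'X)) *: estar i).
Proof.
rewrite Tzero_sum sum_bool_pair [LHS]surjective_pairing.
rewrite (@morphDsum _ _ fst) // (@morphDsum _ _ snd) //.
congr pair; apply: eq_bigr => i _ /=; first by rewrite scaler0 add0r.
by rewrite scaler0 addr0.
Qed.

(** The inverse of [T_0] sends [b] to the pairing with [b]: in coordinates, both
    composites are expansions in the bases [e] and [estar]. *)
Lemma canonical_nondegenerate : tensor_nondegenerate r.
Proof.
split; first exact: Tzero_linear.
exists canonical_form => [f|b]; rewrite ?Tzero_canonical.
  apply: cdualP => v /=.
  have f1P : (fun u : A => f (u, 0)) \in @cdual_pred K A.
    have zf (p : {poly K}) : (0 : cdual A) = p *: 0 by rewrite scaler0.
    apply/asboolP; split=> [k u w|u].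
      rewrite -cdual_lin; congr (f _); congr pair.
      by rewrite [LHS](zf k%:P) [RHS]addr0.
    by rewrite -cdualX; congr (f _); congr pair; exact: zf.
  rewrite -(cdual_expand e_basis estar_dual (CDual f1P)) /=.
  rewrite (morphDsum _ _ (cdualD v.2)) raddf_sum /=.
  have -> : v = (v.1, 0) + (0, v.2).
    by case: v => v1 v2; congr pair; rewrite ?addr0 ?add0r.
  rewrite cdualD /= addr0 add0r; congr (_ + _).
  rewrite {2}(cdual_expand e_basis estar_dual v.2).
  have -> : ((0, \sum_(k < n) (v.2 (e k) \Po - 'X) *: estar k) : B) =
      \sum_(k < n) (v.2 (e k) \Po - 'X) *: ((0, estar k) : B).
    rewrite [RHS]surjective_pairing (@morphDsum _ _ fst) // (@morphDsum _ _ snd) //.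
    by congr pair; rewrite big1 // => i _; rewrite /= scaler0.
  rewrite (morphDsum _ _ (cdualD f)); apply: eq_bigr => i _.
  rewrite !cdual_poly comp_polyM -comp_polyA raddfN /= comp_polyX opprK.
  by rewrite comp_polyXr mulrC.
rewrite [RHS]surjective_pairing; congr pair.
  rewrite [RHS](dual_basis_expand e_basis estar_dual); apply: eq_bigr => i _.
  rewrite /= (morphD0 (cdualD _)) add0r -comp_polyA raddfN /= comp_polyX opprK.
  by rewrite comp_polyXr.
rewrite [RHS](cdual_expand e_basis estar_dual); apply: eq_bigr => i _ /=.
rewrite [X in X \Po _](_ : _ = b.2 (e i)) //.
by rewrite [X in _ + X](_ : _ = 0) ?addr0 //; exact: comp_poly0.
Qed.

End SemidirectCanonical.

Section Symmetry.
Variable K : numFieldType.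

Lemma symmetrized_tensor_symmetric (U : lmodType {poly K}) (I : finType)
    (u v : I -> U) :
  tensor_symmetric (\sum_i (tens2 (u i) (v i) + tens2 (v i) (u i))).
Proof.
have bl : bilin (fun x y : kmod U => tens y x : tensor2 U).
  by split=> x; [exact: (tens_bilin _ _).2|exact: (tens_bilin _ _).1].
rewrite /tensor_symmetric (morphDsum _ _ (tsum_add bl)).
apply: eq_bigr => i _; rewrite [RHS](tsum_add bl) !tsum_tens //.
exact: addrC.
Qed.

End Symmetry.

Unset Implicit Arguments.
Set Strict Implicit.
Set Printing Implicit Defensive.

Theorem corollary5p4 (R : realType) (A : lsca R[i]) (Afin : cfinite A)
    (n : nat) (e : 'I_n -> A) (estar : 'I_n -> cdual A)
    (e_basis : cbasis e)
    (estar_dual : forall i k : 'I_n, estar i (e k) = (i == k)%:R) :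
  let B : lsca R[i] := semidirect Afin in
  let r : tensor2 B := \sum_(i < n)
    (tens2 ((e i, 0) : B) ((0, estar i) : B)
     + tens2 ((0, estar i) : B) ((e i, 0) : B)) in
  [/\ tensor_symmetric r, tensor_nondegenerate r & conformal_S_equation r].
Proof.
move=> B r; rewrite {}/r; split.
- exact: (symmetrized_tensor_symmetric
    (fun i => (e i, 0) : B) (fun i => (0, estar i) : B)).
- rewrite -canonical_tensorE.
  exact: (canonical_nondegenerate Afin e_basis estar_dual).
- rewrite -canonical_tensorE; apply: (S_equation_of_invariant (B := B)).
  exact: (canonical_invariant e_basis estar_dual).
Qed.
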